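(* Let $\Gamma$ be a countable discrete group, $X$ a compact $\Gamma$-space, $\Lambda\leq\Gamma$ a subgroup, and $K\subset X$ a closed, $\Lambda$-invariant subset such that $\Gamma_x^\circ\leq\Lambda$ for each $x\in K$. Let $\nu$ be a $\sigma$-finite, $\Lambda$-quasi-invariant Borel measure on $K$, and let $(L^2(K,\nu),\kappa,\rho)$ be the associated Koopman representation of the dynamical system $(\Lambda,X)$. Then the induced covariant representation $\mathrm{Ind}_\Lambda^\Gamma(L^2(K,\nu),\kappa,\rho)$ is a germinal covariant representation of $(\Gamma,X)$.
   Context: For $g\in\Gamma$, $\mathrm{Fix}(g)=\{x\in X: gx=x\}$, with interior $\mathrm{Fix}(g)^\circ$, and $\Gamma_x^\circ=\{g\in\Gamma: g\text{ fixes pointwise a neighborhood of }x\text{ in }X\}$. $\Gamma$ acts on $C(X)$ by $(g\cdot f)(x)=f(g^{-1}x)$. A covariant representation $(\mathcal{H},\pi,\rho)$ of $(\Gamma,X)$ consists of a Hilbert space $\mathcal{H}$, a unitary representation $\pi$ of $\Gamma$ and a $*$-representation $\rho$ of $C(X)$ on $\mathcal{H}$ with $\pi(g)\rho(f)\pi(g)^*=\rho(g\cdot f)$ (similarly for $(\Lambda,X)$). It is germinal if $\pi(g)\rho(f)=\rho(f)$ for all $g\in\Gamma$ and all $f\in C(X)$ with $\mathrm{supp}(f)\subset\mathrm{Fix}(g)^\circ$. The Koopman representation $(L^2(K,\nu),\kappa,\rho)$ of $(\Lambda,X)$ is given by $[\kappa(h)\xi](x)=\left(\frac{dh\nu}{d\nu}(x)\right)^{1/2}\xi(h^{-1}x)$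 and $[\rho(f)\xi](x)=f(x)\xi(x)$ for a.e. $x\in K$ ($h\in\Lambda$, $f\in C(X)$). For a covariant representation $(\mathcal{K},\sigma,\rho)$ of $(\Lambda,X)$, the induced covariant representation $\mathrm{Ind}_\Lambda^\Gamma(\mathcal{K},\sigma,\rho)=(\mathrm{Ind}_\Lambda^\Gamma\mathcal{K},\mathrm{Ind}_\Lambda^\Gamma\sigma,\mathrm{Ind}_\Lambda^\Gamma\rho)$ of $(\Gamma,X)$ acts on the Hilbert space of functions $\xi:\Gamma\to\mathcal{K}$ with $\xi(th)=\sigma(h^{-1})\xi(t)$ ($t\in\Gamma,h\in\Lambda$) and $\sum_{r\in\mathcal{R}}\|\xi(r)\|^2<\infty$ ($\mathcal{R}$ a left transversal of $\Gamma/\Lambda$), by $[\mathrm{Ind}_\Lambda^\Gamma\sigma(g)\xi](t)=\xi(g^{-1}t)$ and $[\mathrm{Ind}_\Lambda^\Gamma\rho(f)\xi](t)=\rho(t^{-1}\cdot f)\xi(t)$. *)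

(* Defs.v *)
From HB Require Import structures.
From mathcomp Require Import all_boot all_order all_algebra.
From mathcomp Require Import all_classical all_reals all_analysis.
From mathcomp Require Import complex.

Set Implicit Arguments.
Unset Strict Implicit.
Unset Printing Implicit Defensive.
Import Order.TTheory GRing.Theory Num.Theory numFieldNormedType.Exports.
Local Open Scope classical_set_scope.
Local Open Scope ring_scope.

Section Hilbert.
Variable R : realType.

(* A Hilbert space is presented by representatives, in the way L^2 is presented
   by functions: [dom] is a subspace of the vector space [vec], [ip] is a
   positive semidefinite form on it, linear in the first variable, and elements
   of [dom] at distance 0 denote the same vector.  The Hilbert space itself is
   the quotient of [dom] by that identification; accordingly, identities between
   vectors are stated with [veq], and operators are maps between
   representatives. *)
Record hspace := HSpace {
  vec :> lmodType R[i];
  dom : set vec;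
  ip : vec -> vec -> R[i] }.

Section space.
Variable H : hspace.
Implicit Types (x y z : H) (a : R[i]) (u : nat -> H) (A : H -> H).

Definition vnorm x : R := Num.sqrt (complex.Re (ip x x)).

Definition veq x y : Prop := ip (x - y) (x - y) = 0.

Definition subspace_dom : Prop :=
  dom (0 : H) /\ forall a x y, dom x -> dom y -> dom (a *: x + y).

Definition inner_product : Prop :=
  [/\ forall a x y z, dom x -> dom y -> dom z ->
        ip (a *: x + y) z = a * ip x z + ip y z,
      forall x y, dom x -> dom y -> ip y x = (ip x y)^*%C
    & forall x, dom x -> 0 <= ip x x].

Definition complete_space : Prop :=
  forall u, (forall n, dom (u n)) ->
    (forall e : R, 0 < e -> exists N : nat, forall m n : nat,
      (N <= m)%N -> (N <= n)%N -> vnorm (u m - u n) < e) ->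
    exists2 l : H, dom l & forall e : R, 0 < e -> exists N : nat,
      forall n : nat, (N <= n)%N -> vnorm (u n - l) < e.

Definition hilbert : Prop :=
  [/\ subspace_dom, inner_product & complete_space].

(* Boundedness makes [A] compatible with [veq]. *)
Definition bounded_operator A : Prop :=
  [/\ forall x, dom x -> dom (A x),
      forall a x y, dom x -> dom y -> veq (A (a *: x + y)) (a *: A x + A y)
    & exists M : R, forall x, dom x -> vnorm (A x) <= M * vnorm x].

Definition unitary_operator A : Prop :=
  [/\ bounded_operator A,
      forall x y, dom x -> dom y -> ip (A x) (A y) = ip x y
    & forall y, dom y -> exists2 x, dom x & veq (A x) y].

End space.
End Hilbert.

Section Covariant.
Variable R : realType.

Definition continuous_action (G : groupType) (X : topologicalType)
    (act : G -> X -> X) : Prop :=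
  [/\ forall x, act 1%g x = x,
      forall g h x, act (g * h)%g x = act g (act h x)
    & forall g, continuous (act g)].

Definition fixed_points (G : groupType) (X : topologicalType)
    (act : G -> X -> X) (g : G) : set X := [set x | act g x = x].

Definition germ_stabilizer (G : groupType) (X : topologicalType)
    (act : G -> X -> X) (x : X) : set G :=
  [set g | \forall y \near x, act g y = y].

Definition CX (X : topologicalType) : set (X -> R[i]) :=
  [set f | continuous (f : X -> R[i]^o)].

Definition supp (X : topologicalType) (f : X -> R[i]) : set X :=
  closure [set x | f x != 0].

Definition fun_act (G : groupType) (X : Type) (act : G -> X -> X)
    (g : G) (f : X -> R[i]) : X -> R[i] := fun x => f (act g^-1%g x).

(* The values of [rep_rho] outside [CX] are irrelevant. *)
Record rep_data (G : groupType) (X : topologicalType) := RepData {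
  rep_space :> hspace R;
  rep_pi : G -> rep_space -> rep_space;
  rep_rho : (X -> R[i]) -> rep_space -> rep_space }.

Section rep.
Variables (G : groupType) (X : topologicalType) (act : G -> X -> X).
Variable (D : rep_data G X).

Definition unitary_representation : Prop :=
  [/\ forall g, unitary_operator (rep_pi (r := D) g),
      forall x : D, dom x -> veq (rep_pi 1%g x) x
    & forall g h (x : D), dom x -> veq (rep_pi (g * h)%g x) (rep_pi g (rep_pi h x))].

Definition star_rep : Prop :=
  (forall f, CX f -> bounded_operator (rep_rho (r := D) f)) /\
  [/\ forall (a : R[i]) f1 f2 (x : D), CX f1 -> CX f2 -> dom x ->
        veq (rep_rho (fun t => a * f1 t + f2 t) x) (a *: rep_rho f1 x + rep_rho f2 x),
      forall f1 f2 (x : D), CX f1 -> CX f2 -> dom x ->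
        veq (rep_rho (fun t => f1 t * f2 t) x) (rep_rho f1 (rep_rho f2 x)),
      forall x : D, dom x -> veq (rep_rho (fun=> 1) x) x
    & forall f (x y : D), CX f -> dom x -> dom y ->
        ip (rep_rho (fun t => (f t)^*%C) x) y = ip x (rep_rho f y)].

(* [rep_pi g^-1] is the adjoint of the unitary [rep_pi g]. *)
Definition covariant_rep : Prop :=
  [/\ hilbert D, unitary_representation, star_rep
    & forall g f (x : D), CX f -> dom x ->
        veq (rep_pi g (rep_rho f (rep_pi g^-1%g x))) (rep_rho (fun_act act g f) x)].

Definition germinal : Prop :=
  forall g f (x : D), CX f -> supp f `<=` (fixed_points act g)° -> dom x ->
    veq (rep_pi g (rep_rho f x)) (rep_rho f x).

End rep.
End Covariant.

Section Koopman.
Variables (R : realType) (X : ptopologicalType).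

Definition borel : Type := g_sigma_algebraType (@open X).
HB.instance Definition _ := Measurable.copy borel (g_sigma_algebraType (@open X)).

(* L^2(K, nu) for a closed subset K is L^2 nu for nu a measure on the Borel sets
   of X that vanishes on the complement of K. *)
Variable nu : {measure set borel -> \bar R}.

Definition cintegral (f : X -> R[i]) : R[i] :=
  ((\int[nu]_(x in [set: borel]) complex.Re (f x)) +i*
   (\int[nu]_(x in [set: borel]) complex.Im (f x)))%C.

Definition normc_sq (z : R[i]) : R := complex.Re z ^+ 2 + complex.Im z ^+ 2.

Definition square_integrable : set (X -> R[i]^o) :=
  [set f | [/\ measurable_fun [set: borel] (fun x : borel => complex.Re (f x)),
               measurable_fun [set: borel] (fun x : borel => complex.Im (f x))
             & (\int[nu]_(x in [set: borel]) (normc_sq (f x))%:E < +oo)%E]].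

Definition L2 : hspace R :=
  @HSpace R (X -> R[i]^o) square_integrable
    (fun f g => cintegral (fun x => f x * (g x)^*%C)).

Variables (G : groupType) (act : G -> X -> X).

Definition quasi_invariant : Prop :=
  forall (g : G) (A : set borel), measurable A ->
    (nu (act g @^-1` A) = 0%E <-> nu A = 0%E).

Definition is_RN_derivative (g : G) : set (X -> R) :=
  [set D : X -> R | [/\ measurable_fun [set: borel] (D : borel -> R), forall x, 0 <= D x
    & forall A : set borel, measurable A ->
        nu (act g @^-1` A) = (\int[nu]_(x in A) (D x)%:E)%E]].

(* The Radon-Nikodym derivative of the translate g nu of nu, with respect to
   nu; [Radon_Nikodym] requires g nu to be finite.  It exists when nu is
   sigma-finite and quasi-invariant; 0 is a default value. *)
Definition RN_derivative (g : G) : X -> R :=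
  xget (cst 0) (is_RN_derivative g).

Definition koopman_pi (g : G) (xi : L2) : L2 :=
  fun x => ((Num.sqrt (RN_derivative g x))%:C)%C * xi (act g^-1%g x).

Definition koopman : rep_data R G X :=
  @RepData R G X L2 koopman_pi (fun f xi x => f x * xi x).

End Koopman.

Section Induced.
Variable R : realType.

Definition rsum (I : choiceType) (S : set I) (f : I -> R) : R :=
  fine (\esum_(i in S) ((EFin \o f)^\+ i)%E) -
  fine (\esum_(i in S) ((EFin \o f)^\- i)%E).

Definition csum (I : choiceType) (S : set I) (f : I -> R[i]) : R[i] :=
  (rsum S (fun i => complex.Re (f i)) +i* rsum S (fun i => complex.Im (f i)))%C.

Variables (Gamma : groupType) (P : pred Gamma) (Lambda : subGroupType P).

Definition left_transversal (T : set Gamma) : Prop :=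
  forall t : Gamma,
    exists! r, T r /\ exists h : Lambda, t = (r * \val h)%g.

Variables (T : set Gamma) (X : topologicalType) (act : Gamma -> X -> X).
Variable D : rep_data R Lambda X.

Definition induced_dom : set (Gamma -> D) :=
  [set xi | [/\ forall t, dom (xi t),
                forall t (h : Lambda),
                  veq (xi (t * \val h)%g) (rep_pi h^-1%g (xi t))
              & (\esum_(r in T) ((vnorm (xi r)) ^+ 2)%:E < +oo)%E]].

Definition induced_space : hspace R :=
  @HSpace R (Gamma -> D) induced_dom
    (fun xi eta => csum T (fun r => ip (xi r) (eta r))).

Definition induced_rep : rep_data R Gamma X :=
  @RepData R Gamma X induced_space
    (fun g xi t => xi (g^-1 * t)%g)
    (fun f xi t => rep_rho (fun_act act t^-1%g f) (xi t)).

End Induced.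

(* Main.v *)
(** The Koopman representation is unitary and multiplicative because the
    Radon-Nikodym derivatives of the translates of [nu] satisfy the cocycle
    identity [D (g h) x = D g x * D h (g^-1 x)] a.e., by uniqueness of densities.
    Induction is an l^2-sum over the transversal [T]: left translation by [g]
    permutes the cosets, and the norm of [xi t] depends only on the coset of [t].

    For germinality, evaluate at [r] in [T].  Since [supp f] lies in
    [Fix(g)°], [f] is constant along [g], so that [pi g (rho f xi)] and
    [rho f xi] differ at [r] by the factor [xi (g^-1 r)] against [xi r],
    multiplied by [f o r].  If [f o r] vanishes on [K] both are null.  Otherwise
    [h = r^-1 g r] belongs to some germ stabilizer of a point of [K], hence to
    [Lambda], and [xi (g^-1 r) = kappa h (xi r)], which agrees with [xi r] on the
    open set [r^-1 Fix(g)°] because [h] fixes it pointwise and [D h = 1] there. *)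
From HB Require Import structures.
Require Import Defs.
From mathcomp Require Import all_boot all_order all_algebra.
From mathcomp Require Import all_classical all_reals all_analysis.
From mathcomp Require Import measurable_realfun complex ring lra.
Set Implicit Arguments.
Unset Strict Implicit.
Unset Printing Implicit Defensive.
Import Order.TTheory GRing.Theory Num.Theory numFieldNormedType.Exports.
Local Open Scope classical_set_scope.
Local Open Scope ring_scope.

(** * Hilbert spaces given by representatives *)

(** Since vectors are representatives, linearity, the group law and covariance hold only up to null
    vectors. A representative can be exchanged under an operator only because bounded operators send
    null vectors to null vectors ([bounded_veq]), and chains of [veq] need all their terms in [dom].
    In the germinality argument the element [h] does not depend on the point: a single [y] in [K]
    with [f (act r y)] nonzero puts [h] in [Lambda], and the same [h] then serves on all of
    [r^-1 Fix(g)°]. Interiors matter because a density is determined only almost everywhere: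
    [D h = 1] is not a statement about a point, but on a Borel set fixed pointwise by [h] the
    measures [h nu] and [nu] have the same Borel restrictions. The set [K] enters through [nu]
    alone: it is closed, hence Borel, with null complement, so an identity in L^2 has to be checked
    only on [K]. *)

Section pre_hilbert.
Variables (R : realType) (H : hspace R).
Hypotheses (Hs : subspace_dom H) (Hi : inner_product H).
Implicit Types (x y z : H) (a : R[i]).

(** Estimates are carried out on squared norms, which avoids Cauchy-Schwarz; the price is the factor
    2 in [nsqD_le] and [nsq_tri]. *)
Definition nsq x : R := complex.Re (ip x x).

Lemma dom0 : dom (0 : H). Proof. by case: Hs. Qed.

Lemma domZ a x : dom x -> dom (a *: x).
Proof. by move=> dx; rewrite -[_ *: _]addr0; case: Hs => d0; apply. Qed.

Lemma domD x y : dom x -> dom y -> dom (x + y).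
Proof. by move=> dx dy; rewrite -[x]scale1r; case: Hs => d0; apply. Qed.

Lemma domB x y : dom x -> dom y -> dom (x - y).
Proof. by move=> dx dy; apply: domD => //; rewrite -scaleN1r; exact: domZ. Qed.

Lemma domZD a x y : dom x -> dom y -> dom (a *: x + y).
Proof. by move=> dx dy; apply: domD => //; exact: domZ. Qed.

Lemma ipZDl a x y z : dom x -> dom y -> dom z ->
  ip (a *: x + y) z = a * ip x z + ip y z.
Proof. by case: Hi => + _ _; apply. Qed.

Lemma ipC x y : dom x -> dom y -> ip y x = (ip x y)^*%C.
Proof. by case: Hi => _ + _; apply. Qed.

Lemma ip0l z : dom z -> ip 0 z = 0.
Proof.
move=> dz; have := ipZDl 1 dom0 dom0 dz.
by rewrite scaler0 addr0 mul1r => /eqP; rewrite addrC -subr_eq subrr eq_sym => /eqP.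
Qed.

Lemma ipDl x y z : dom x -> dom y -> dom z -> ip (x + y) z = ip x z + ip y z.
Proof. by move=> *; rewrite -{1}[x]scale1r ipZDl// mul1r. Qed.

Lemma ipZl a x z : dom x -> dom z -> ip (a *: x) z = a * ip x z.
Proof.
move=> dx dz; have d0 := dom0.
by rewrite -[a *: x]addr0 ipZDl// ip0l// addr0.
Qed.

Lemma ipDr x y z : dom x -> dom y -> dom z -> ip z (x + y) = ip z x + ip z y.
Proof.
move=> dx dy dz; have dxy := domD dx dy.
by rewrite (ipC dxy dz) (ipC dx dz) (ipC dy dz) ipDl// rmorphD.
Qed.

Lemma ipZr a x z : dom x -> dom z -> ip z (a *: x) = a^*%C * ip z x.
Proof.
move=> dx dz; have dax := domZ a dx.
by rewrite (ipC dax dz) (ipC dx dz) ipZl// rmorphM.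
Qed.

Lemma ip_nsq x : dom x -> ip x x = (nsq x)%:C%C.
Proof.
case: Hi => _ _ /[apply]; rewrite /nsq.
by case: (ip x x) => u v; rewrite lecE/= => /andP[/eqP -> _].
Qed.

Lemma nsq_ge0 x : dom x -> 0 <= nsq x.
Proof. by case: Hi => _ _ + dx => /(_ _ dx); rewrite ip_nsq// lecR. Qed.

Lemma vnorm_sq x : dom x -> vnorm x ^+ 2 = nsq x.
Proof. by move=> dx; rewrite sqr_sqrtr//; exact: nsq_ge0. Qed.

Lemma veqP x y : dom x -> dom y -> veq x y <-> nsq (x - y) = 0.
Proof.
move=> dx dy; rewrite /veq ip_nsq; last exact: domB.
by split=> [[]|->].
Qed.

Lemma nsqZ a x : dom x -> nsq (a *: x) = normc_sq a * nsq x.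
Proof.
move=> dx; have dax := domZ a dx.
rewrite /nsq ipZl// ipZr// ip_nsq//=.
by case: a dax => u v _; rewrite /normc_sq/=; ring.
Qed.

Lemma nsqD x y : dom x -> dom y ->
  nsq (x + y) = nsq x + nsq y + 2 * complex.Re (ip x y).
Proof.
move=> dx dy; have dxy := domD dx dy.
rewrite /nsq ipDl// !ipDr// (ipC dx dy).
by case: (ip x x) (ip x y) (ip y y) => [a b] [c d] [e f] /=; ring.
Qed.

Lemma nsqN x : dom x -> nsq (- x) = nsq x.
Proof. by move=> dx; rewrite -scaleN1r nsqZ// /normc_sq/=; ring. Qed.

Lemma domN x : dom x -> dom (- x).
Proof. by move=> dx; rewrite -scaleN1r; exact: domZ. Qed.

Lemma nsqB x y : dom x -> dom y ->
  nsq (x - y) = nsq x + nsq y - 2 * complex.Re (ip x y).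
Proof.
move=> dx dy; rewrite nsqD//; last exact: domN.
rewrite nsqN// -scaleN1r ipZr//=.
by case: (ip x y) => a b /=; ring.
Qed.

(** Parallelogram law: the right side minus the left side is [nsq (x - y)]. *)
Lemma nsqD_le x y : dom x -> dom y -> nsq (x + y) <= 2 * nsq x + 2 * nsq y.
Proof.
move=> dx dy; have := nsq_ge0 (domB dx dy).
by rewrite nsqB// nsqD//; lra.
Qed.

Lemma nsq_tri y x z : dom x -> dom y -> dom z ->
  nsq (x - z) <= 2 * nsq (x - y) + 2 * nsq (y - z).
Proof.
by move=> dx dy dz; rewrite -(subrKA y); apply: nsqD_le; exact: domB.
Qed.

Lemma nsqBC x y : dom x -> dom y -> nsq (x - y) = nsq (y - x).
Proof. by move=> dx dy; rewrite -opprB nsqN//; exact: domB. Qed.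

(** A weak substitute for Cauchy-Schwarz, read off from the positivity of [nsq (x + y)] and
    [nsq (x - y)]. It is enough to make the series of inner products over a transversal absolutely
    summable. *)
Lemma normr_Re_ip_le x y : dom x -> dom y ->
  `|complex.Re (ip x y)| <= nsq x + nsq y.
Proof.
move=> dx dy; have := nsq_ge0 (domB dx dy); have := nsq_ge0 (domD dx dy).
have := nsq_ge0 dx; have := nsq_ge0 dy.
by rewrite nsqB// nsqD// ler_norml => *; apply/andP; split; lra.
Qed.

Lemma Im_ip x y : dom x -> dom y ->
  complex.Im (ip x y) = complex.Re (ip x ('i%C *: y)).
Proof. by move=> dx dy; rewrite ipZr//; case: (ip x y) => a b /=; ring. Qed.

Lemma normr_Im_ip_le x y : dom x -> dom y ->
  `|complex.Im (ip x y)| <= nsq x + nsq y.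
Proof.
move=> dx dy; have diy := domZ 'i%C dy.
rewrite Im_ip// (le_trans (normr_Re_ip_le dx diy))// nsqZ// /normc_sq/=.
by rewrite expr0n expr1n add0r mul1r.
Qed.

Lemma veq_refl x : veq x x.
Proof. by rewrite /veq subrr ip0l//; exact: dom0. Qed.

Lemma veq_sym x y : dom x -> dom y -> veq x y -> veq y x.
Proof. by move=> dx dy; rewrite !veqP// nsqBC. Qed.

Lemma veq_trans y x z : dom x -> dom y -> dom z ->
  veq x y -> veq y z -> veq x z.
Proof.
move=> dx dy dz; rewrite !veqP// => xy yz; apply/le_anti.
rewrite nsq_ge0 ?andbT; last exact: domB.
by rewrite (le_trans (nsq_tri dx dy dz))// xy yz !mulr0 addr0.
Qed.

Lemma veqZD a x x' y y' : dom x -> dom x' -> dom y -> dom y' ->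
  veq x x' -> veq y y' -> veq (a *: x + y) (a *: x' + y').
Proof.
move=> dx dx' dy dy'; rewrite !veqP//; try exact: domZD.
move=> xx yy; apply/le_anti; rewrite nsq_ge0 ?andbT; last first.
  by apply: domB; exact: domZD.
rewrite opprD addrACA -scalerBr (le_trans (nsqD_le _ _))//; last 3 first.
- by apply: domZ; exact: domB.
- exact: domB.
- by rewrite nsqZ ?xx ?yy ?mulr0 ?addr0//; exact: domB.
Qed.

(* A null vector [w] is orthogonal to everything, since
   [0 <= nsq (y + t w) = nsq y + 2 t Re (ip y w)] for all real [t]. *)
Lemma nsq_veq x y : dom x -> dom y -> veq x y -> nsq x = nsq y.
Proof.
move=> dx dy; rewrite veqP//; move: (domB dx dy) => dw w0.
rewrite -(subrK y x) addrC nsqD// w0 addr0.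
suff -> : complex.Re (ip y (x - y)) = 0 by rewrite mulr0 addr0.
have : forall t : R, 0 <= nsq y + 2 * (t * complex.Re (ip y (x - y))).
  move=> t; have dtw := domZ t%:C%C dw.
  have := nsq_ge0 (domD dy dtw); rewrite nsqD// nsqZ// w0 mulr0 addr0 ipZr//=.
  by case: (ip y _) => a b /=; rewrite oppr0 mul0r subr0.
move: (complex.Re _) (nsq y) => r q rq; apply/eqP/negPn/negP => r0.
(* This [t] makes the affine function equal to [q - 2 * (q + 1)], which is negative because [rq 0]
   gives [0 <= q]. *)
have := rq (- (q + 1) / r).
by rewrite divfK//; have := rq 0; lra.
Qed.

(* By polarization. *)
Lemma isometry_ip (A : H -> H) : (forall x, dom x -> dom (A x)) ->
  (forall a x y, dom x -> dom y -> veq (A (a *: x + y)) (a *: A x + A y)) ->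
  (forall x, dom x -> nsq (A x) = nsq x) ->
  forall x y, dom x -> dom y -> ip (A x) (A y) = ip x y.
Proof.
move=> dA lA nA.
have re x y : dom x -> dom y ->
    complex.Re (ip (A x) (A y)) = complex.Re (ip x y).
  move=> dx dy; have dxy : dom (1 *: x + y) by apply: domZD.
  have := nsq_veq (dA _ dxy) (domZD _ (dA _ dx) (dA _ dy)) (lA 1 x y dx dy).
  by rewrite nA// !scale1r !nsqD ?nA//; [lra|exact: dA..].
move=> x y dx dy; have diy := domZ 'i%C dy.
have dAx := dA _ dx; have dAy := dA _ dy.
apply/eqP; rewrite eq_complex re// eqxx/= !Im_ip// -(re x)//.
have d0 := dom0.
(* Linearity is available only in the combined form [a *: x + y], so homogeneity is its case
   [y = 0], which requires [A 0] to be null. *)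
have A0 : veq (A 0) 0.
  apply/veqP => //; first exact: dA.
  by rewrite subr0 nA// /nsq ip0l.
have e : veq (A ('i%C *: y)) ('i%C *: A y).
  rewrite -[X in A X]addr0 -[X in veq _ X]addr0.
  apply: (veq_trans (y := 'i%C *: A y + A 0)).
  - by apply: dA; exact: domZD.
  - by apply: domZD => //; exact: dA.
  - exact: domZD.
  - exact: lA.
  - by apply: veqZD => //; [exact: dA|exact: veq_refl].
have dAiy := dA _ diy; have diAy := domZ 'i%C dAy.
have : veq (1 *: A x + A ('i%C *: y)) (1 *: A x + 'i%C *: A y).
  by apply: veqZD => //; exact: veq_refl.
move=> /(nsq_veq (domZD _ dAx dAiy) (domZD _ dAx diAy)).
rewrite !scale1r !nsqD// (nsq_veq _ _ e)// => E.
by apply/eqP; lra.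
Qed.

Lemma isometry_unitary (A : H -> H) : (forall x, dom x -> dom (A x)) ->
  (forall a x y, dom x -> dom y -> veq (A (a *: x + y)) (a *: A x + A y)) ->
  (forall x, dom x -> nsq (A x) = nsq x) ->
  (forall y, dom y -> exists2 x, dom x & veq (A x) y) ->
  unitary_operator A.
Proof.
move=> dA lA nA sA; split=> //; last exact: isometry_ip.
split=> //; exists 1 => x dx.
by rewrite /vnorm -!/(nsq _) nA// mul1r.
Qed.

Lemma bounded_operator_sq (A : H -> H) (M : R) :
  (forall x, dom x -> dom (A x)) ->
  (forall a x y, dom x -> dom y -> veq (A (a *: x + y)) (a *: A x + A y)) ->
  (forall x, dom x -> nsq (A x) <= M * nsq x) ->
  bounded_operator A.
Proof.
move=> dA lA bA; split=> //; exists (Num.sqrt `|M|) => x dx.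
rewrite /vnorm -!/(nsq _) -sqrtrM//; apply: ler_wsqrtr.
by rewrite (le_trans (bA _ dx))// ler_wpM2r ?nsq_ge0// ler_norm.
Qed.

Lemma bounded_veqB (A : H -> H) x y : bounded_operator A -> dom x -> dom y ->
  veq (A (x - y)) (A x - A y).
Proof.
move=> [_ lA _] dx dy; have := lA (-1) y x dy dx.
by rewrite !scaleN1r ![- _ + _]addrC.
Qed.

Lemma veqB x x' y y' : dom x -> dom x' -> dom y -> dom y' ->
  veq x x' -> veq y y' -> veq (x - y) (x' - y').
Proof.
move=> dx dx' dy dy' xx yy; have := veqZD (-1) dy dy' dx dx' yy xx.
by rewrite !scaleN1r ![- _ + _]addrC.
Qed.

Lemma bounded_veq (A : H -> H) x y : bounded_operator A -> dom x -> dom y ->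
  veq x y -> veq (A x) (A y).
Proof.
move=> bA dx dy; have [dA _ [M MA]] := bA; rewrite !veqP//; try exact: dA.
move=> xy; have dxy := domB dx dy; have dd := domB (dA _ dx) (dA _ dy).
rewrite -(nsq_veq (dA _ dxy) dd (bounded_veqB bA dx dy)) -vnorm_sq; last exact: dA.
have -> : vnorm (A (x - y)) = 0; last by rewrite expr0n.
by apply/le_anti; rewrite sqrtr_ge0 (le_trans (MA _ dxy))// {1}/vnorm -/(nsq _) xy sqrtr0 mulr0.
Qed.

Lemma unitary_nsq (A : H -> H) x : unitary_operator A -> dom x ->
  nsq (A x) = nsq x.
Proof. by move=> [_ iA _] dx; rewrite /nsq iA. Qed.

End pre_hilbert.

(** * Unordered sums *)

Section rsum_theory.
Variables (R : realType) (I : choiceType) (S : set I).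
Implicit Types (f g : I -> R) (F G : I -> R[i]).

Lemma esumZ (c : R) (a : I -> \bar R) : 0 <= c ->
  (forall i, 0 <= a i)%E ->
  (\esum_(i in S) (c%:E * a i) = c%:E * \esum_(i in S) a i)%E.
Proof.
(* One inequality suffices: the converse is the same inequality for the scalar [c^-1] and the family
   [c * a]. *)
have le (k : R) (b : I -> \bar R) : 0 <= k -> (forall i, 0 <= b i)%E ->
    (\esum_(i in S) (k%:E * b i) <= k%:E * \esum_(i in S) b i)%E.
  move=> k0 b0; apply: ge_ereal_sup => _ [Y [finY YS] <-].
  rewrite -ge0_mule_fsumr//.
  by rewrite lee_wpmul2l// esum_ge//; exists Y.
rewrite le_eqVlt => /predU1P[<- a0|c0 a0].
  by rewrite mul0e esum1// => i Si; rewrite mul0e.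
apply/le_anti; rewrite le//=; last exact: ltW.
have ca0 i : (0 <= c%:E * a i)%E by rewrite mule_ge0 ?a0// lee_fin ltW.
have ci0 : 0 <= c^-1 by rewrite invr_ge0 ltW.
have := le _ _ ci0 ca0.
under eq_esum do rewrite muleA -EFinM mulVf ?gt_eqF// mul1e.
by rewrite -(@lee_pmul2l _ c%:E)// muleA -EFinM divff ?gt_eqF// mul1e.
Qed.

Lemma esum_fin_num (f : I -> R) : (forall i, S i -> 0 <= f i) ->
  (\esum_(i in S) (f i)%:E < +oo)%E -> \esum_(i in S) (f i)%:E \is a fin_num.
Proof. by move=> f0 h; rewrite ge0_fin_numE// esum_ge0. Qed.

Lemma summable_le f g : (\esum_(i in S) (g i)%:E < +oo)%E ->
  (forall i, S i -> `|f i| <= g i) -> summable S (EFin \o f).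
Proof.
by move=> gS fg; apply: le_lt_trans gS; apply: le_esum => i Si; rewrite lee_fin fg.
Qed.

Lemma summable_ge0 f : (forall i, S i -> 0 <= f i) ->
  (\esum_(i in S) (f i)%:E < +oo)%E -> summable S (EFin \o f).
Proof. by move=> f0 fS; apply: (summable_le fS) => i Si; rewrite ger0_norm ?f0. Qed.

(** [rsum] is defined by the positive and negative parts, but any difference of nonnegative families
    with finite sums computes it. This freedom is what yields additivity and homogeneity. *)
Lemma rsumB_ge0 f g : (forall i, S i -> 0 <= f i) -> (forall i, S i -> 0 <= g i) ->
  (\esum_(i in S) (f i)%:E < +oo)%E -> (\esum_(i in S) (g i)%:E < +oo)%E ->
  rsum S (fun i => f i - g i) =
  fine (\esum_(i in S) (f i)%:E) - fine (\esum_(i in S) (g i)%:E).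
Proof.
move=> f0 g0 fS gS.
have sf := summable_ge0 f0 fS; have sg := summable_ge0 g0 gS.
have := esumB sf sg; rewrite /comp => /(_ f0 g0) E.
have sfg := summableB sf sg.
rewrite -fineB ?esum_fin_num// -E fineB.
- by rewrite /rsum.
- rewrite ge0_fin_numE ?esum_ge0//.
  apply: le_lt_trans (summable_funepos sfg); apply: le_esum => i _.
  exact: lee_abs.
- rewrite ge0_fin_numE ?esum_ge0//.
  apply: le_lt_trans (summable_funeneg sfg); apply: le_esum => i _.
  exact: lee_abs.
Qed.

Lemma eq_rsum f g : (forall i, S i -> f i = g i) -> rsum S f = rsum S g.
Proof.
move=> fg; rewrite /rsum; congr (fine _ - fine _); apply: eq_esum => i Si.
- by rewrite !funeposE /= fg.
- by rewrite !funenegE /= fg.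
Qed.

Lemma rsum_ge0E f : (forall i, S i -> 0 <= f i) ->
  rsum S f = fine (\esum_(i in S) (f i)%:E).
Proof.
move=> f0; rewrite /rsum [X in _ - fine X]esum1 ?subr0; last first.
  by move=> i Si; rewrite funenegE/= max_r// lee_fin oppr_le0 f0.
by congr fine; apply: eq_esum => i Si; rewrite funeposE/= max_l// lee_fin f0.
Qed.

Definition rpos f i : R := Num.max (f i) 0.
Definition rneg f i : R := Num.max (- f i) 0.

Lemma rposneg f i : f i = rpos f i - rneg f i.
Proof. by rewrite /rpos /rneg; case: (leP (f i) 0); case: (leP (- f i) 0); lra. Qed.

Lemma rpos_ge0 f i : 0 <= rpos f i. Proof. by rewrite le_max lexx orbT. Qed.
Lemma rneg_ge0 f i : 0 <= rneg f i. Proof. by rewrite le_max lexx orbT. Qed.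

Lemma rpos_fin f : summable S (EFin \o f) -> (\esum_(i in S) (rpos f i)%:E < +oo)%E.
Proof.
apply: le_lt_trans; apply: le_esum => i _; rewrite lee_fin /rpos ge_max.
by rewrite ler_norm normr_ge0.
Qed.

Lemma rneg_fin f : summable S (EFin \o f) -> (\esum_(i in S) (rneg f i)%:E < +oo)%E.
Proof.
apply: le_lt_trans; apply: le_esum => i _; rewrite lee_fin /rneg ge_max.
by rewrite -normrN ler_norm normr_ge0.
Qed.

Lemma rsumE f : summable S (EFin \o f) ->
  rsum S f = fine (\esum_(i in S) (rpos f i)%:E) - fine (\esum_(i in S) (rneg f i)%:E).
Proof.
move=> sf; rewrite -rsumB_ge0; [|by move=> *; rewrite ?rpos_ge0 ?rneg_ge0..|exact: rpos_fin|exact: rneg_fin].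
by apply: eq_rsum => i _; exact: rposneg.
Qed.

(** Summability is essential, as [fine] turns an infinite sum into 0. The decomposition of [f + g]
    used here adds the parts of [f] and [g]; these need not be the positive and negative parts of
    the sum. *)
Lemma rsumD f g : summable S (EFin \o f) -> summable S (EFin \o g) ->
  rsum S (fun i => f i + g i) = rsum S f + rsum S g.
Proof.
move=> sf sg.
have [pf nf] := (rpos_fin sf, rneg_fin sf).
have [pg ng] := (rpos_fin sg, rneg_fin sg).
have pD : (\esum_(i in S) (rpos f i + rpos g i)%:E =
    \esum_(i in S) (rpos f i)%:E + \esum_(i in S) (rpos g i)%:E)%E.
  by rewrite -esumD// => i _; rewrite lee_fin rpos_ge0.
have nD : (\esum_(i in S) (rneg f i + rneg g i)%:E =
    \esum_(i in S) (rneg f i)%:E + \esum_(i in S) (rneg g i)%:E)%E.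
  by rewrite -esumD// => i _; rewrite lee_fin rneg_ge0.
transitivity (rsum S (fun i => (rpos f i + rpos g i) - (rneg f i + rneg g i))).
  by apply: eq_rsum => i _; rewrite {1}(rposneg f i) {1}(rposneg g i); ring.
rewrite rsumB_ge0.
- rewrite pD nD !fineD ?esum_fin_num//; last 4 first.
  + by move=> i _; exact: rneg_ge0.
  + by move=> i _; exact: rneg_ge0.
  + by move=> i _; exact: rpos_ge0.
  + by move=> i _; exact: rpos_ge0.
  by rewrite (rsumE sf) (rsumE sg); ring.
- by move=> i _; rewrite addr_ge0// rpos_ge0.
- by move=> i _; rewrite addr_ge0// rneg_ge0.
- by rewrite pD lte_add_pinfty.
- by rewrite nD lte_add_pinfty.
Qed.

Lemma rsumN f : rsum S (fun i => - f i) = - rsum S f.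
Proof.
rewrite /rsum opprB; congr (fine _ - fine _); apply: eq_esum => i Si.
- by rewrite funeposE funenegE /= EFinN.
- by rewrite funeposE funenegE /= opprK.
Qed.

Lemma rsumZ c f : summable S (EFin \o f) ->
  rsum S (fun i => c * f i) = c * rsum S f.
Proof.
move=> sf.
(* A negative scalar exchanges the two parts, so the sign is moved outside by [rsumN]. *)
suff pos k : 0 <= k -> rsum S (fun i => k * f i) = k * rsum S f.
  have [c0|c0] := leP 0 c; first exact: pos.
  rewrite -[in RHS](opprK c) mulNr -pos ?oppr_ge0 ?ltW// -rsumN.
  by apply: eq_rsum => i _; rewrite mulNr opprK.
move=> k0; have [pf nf] := (rpos_fin sf, rneg_fin sf).
transitivity (rsum S (fun i => k * rpos f i - k * rneg f i)).
  by apply: eq_rsum => i _; rewrite {1}(rposneg f i) mulrBr.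
have pZ : (\esum_(i in S) (k * rpos f i)%:E = k%:E * \esum_(i in S) (rpos f i)%:E)%E.
  by rewrite -esumZ// => i; rewrite lee_fin rpos_ge0.
have nZ : (\esum_(i in S) (k * rneg f i)%:E = k%:E * \esum_(i in S) (rneg f i)%:E)%E.
  by rewrite -esumZ// => i; rewrite lee_fin rneg_ge0.
have pF : \esum_(i in S) (rpos f i)%:E \is a fin_num.
  by apply: esum_fin_num => // i _; exact: rpos_ge0.
have nF : \esum_(i in S) (rneg f i)%:E \is a fin_num.
  by apply: esum_fin_num => // i _; exact: rneg_ge0.
rewrite rsumB_ge0.
- by rewrite pZ nZ !fineM// (rsumE sf)/= mulrBr.
- by move=> i _; rewrite mulr_ge0// rpos_ge0.
- by move=> i _; rewrite mulr_ge0// rneg_ge0.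
- by rewrite pZ ltey_eq fin_numM.
- by rewrite nZ ltey_eq fin_numM.
Qed.

Lemma summableZ c f : summable S (EFin \o f) ->
  summable S (EFin \o (fun i => c * f i)).
Proof.
rewrite /summable => sf.
have -> : (\esum_(i in S) `|(EFin \o (fun i => c * f i)%R) i| =
    `|c|%:E * \esum_(i in S) `|(EFin \o f) i|)%E.
  by rewrite -esumZ//; apply: eq_esum => i _; rewrite /= normrM.
by apply: lte_mul_pinfty => //; rewrite ?lee_fin.
Qed.

Definition csummable F :=
  summable S (EFin \o (fun i => complex.Re (F i))) /\
  summable S (EFin \o (fun i => complex.Im (F i))).

Lemma eq_csum F G : (forall i, S i -> F i = G i) -> csum S F = csum S G.
Proof. by move=> FG; congr Complex; apply: eq_rsum => i /FG ->. Qed.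

Lemma csumZD (a : R[i]) F G : csummable F -> csummable G ->
  csum S (fun i => a * F i + G i) = a * csum S F + csum S G.
Proof.
move=> [rF iF] [rG iG]; case: a => u v.
have sZD (c d : R) (p q r : I -> R) : summable S (EFin \o p) ->
    summable S (EFin \o q) -> summable S (EFin \o r) ->
    rsum S (fun i => c * p i + d * q i + r i) = c * rsum S p + d * rsum S q + rsum S r.
  move=> sp sq sr; have scp := summableZ c sp; have sdq := summableZ d sq.
  rewrite (rsumD (f := fun i => c * p i + d * q i) (g := r) _ sr); last first.
    exact: (summableD scp sdq).
  by rewrite (rsumD scp sdq) (rsumZ c sp) (rsumZ d sq).
apply/eqP; rewrite eq_complex/= -!mulNr; apply/andP; split; apply/eqP.
- rewrite -sZD//; apply: eq_rsum => i _.
  by case: (F i) (G i) => [? ?] [? ?] /=; ring.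
- rewrite -sZD//; apply: eq_rsum => i _.
  by case: (F i) (G i) => [? ?] [? ?] /=; ring.
Qed.

Lemma csumJ F : csum S (fun i => (F i)^*%C) = (csum S F)^*%C.
Proof.
by congr Complex; rewrite -?rsumN; apply: eq_rsum => i _; case: (F i).
Qed.

Lemma csum_real f : (forall i, S i -> 0 <= f i) ->
  csum S (fun i => (f i)%:C%C) = (fine (\esum_(i in S) (f i)%:E))%:C%C.
Proof.
move=> f0; congr Complex; first exact: rsum_ge0E.
by rewrite rsum_ge0E// esum1.
Qed.

End rsum_theory.

(** * Completeness in terms of squared norms *)

Section completeness.
Variables (R : realType) (H : hspace R).
Hypotheses (Hs : subspace_dom H) (Hi : inner_product H).

Lemma vnorm_lt (x : H) (e : R) : 0 < e -> (vnorm x < e) = (nsq x < e ^+ 2).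
Proof.
move=> e0; rewrite /vnorm -/(nsq x) -[in LHS](gtr0_norm e0) -sqrtr_sqr.
by rewrite ltr_sqrt// exprn_gt0.
Qed.

Definition nsq_cvg (u : nat -> H) (l : H) := forall e : R, 0 < e ->
  exists N : nat, forall n : nat, (N <= n)%N -> nsq (u n - l) < e.

Definition nsq_cauchy (u : nat -> H) := forall e : R, 0 < e ->
  exists N : nat, forall m n : nat, (N <= m)%N -> (N <= n)%N ->
    nsq (u m - u n) < e.

Lemma complete_spaceP : complete_space H <->
  forall u, (forall n, dom (u n)) -> nsq_cauchy u ->
    exists2 l : H, dom l & nsq_cvg u l.
Proof.
split=> cH u du uC.
- have [|l dl ul] := cH u du.
    move=> e e0; have [|N hN] := uC (e ^+ 2); first by rewrite exprn_gt0.
    by exists N => m n Nm Nn; rewrite vnorm_lt// hN.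
  exists l => // e e0; have [|N hN] := ul (Num.sqrt e); first by rewrite sqrtr_gt0.
  exists N => n /hN; rewrite vnorm_lt ?sqrtr_gt0// sqr_sqrtr//.
  exact: ltW.
- have [|l dl ul] := cH u du.
    move=> e e0; have [|N hN] := uC (Num.sqrt e); first by rewrite sqrtr_gt0.
    exists N => m n Nm /(hN _ _ Nm).
    by rewrite vnorm_lt ?sqrtr_gt0// sqr_sqrtr//; exact: ltW.
  exists l => // e e0; have [|N hN] := ul (e ^+ 2); first by rewrite exprn_gt0.
  by exists N => n /hN; rewrite vnorm_lt.
Qed.

Lemma nsq_small (x : H) : dom x -> (forall e : R, 0 < e -> nsq x <= e) -> nsq x = 0.
Proof.
move=> dx h; apply/le_anti; rewrite nsq_ge0// andbT.
by apply/ler_addgt0Pr => e e0; rewrite add0r h.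
Qed.

(** Operators act on representatives, so [A 0] may be a nonzero null vector; the bound
    [vnorm (A 0) <= M * vnorm 0] shows that it is null. *)
Lemma bounded0 (A : H -> H) : bounded_operator A -> veq (A 0) 0.
Proof.
move=> [dA _ [M bA]]; have d0 := dom0 Hs; have dA0 := dA _ d0.
apply/veqP => //; rewrite subr0 -vnorm_sq//.
suff -> : vnorm (A 0) = 0 by rewrite expr0n.
apply/le_anti; rewrite sqrtr_ge0 andbT (le_trans (bA _ d0))//.
by rewrite /vnorm (ip0l Hs Hi d0) /= sqrtr0 mulr0.
Qed.

End completeness.

(** * Induced representations *)

Section induction.
Variables (R : realType) (Gamma : groupType) (P : pred Gamma).
Variables (Lambda : subGroupType P) (T : set Gamma) (X : topologicalType).
Variables (act : Gamma -> X -> X) (D : rep_data R Lambda X).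
Hypothesis hT : left_transversal Lambda T.
Hypothesis hD : hilbert D.
Hypothesis uD : unitary_representation D.

Let Ind := induced_rep T act D.
Let Hs : subspace_dom D. Proof. by case: hD. Qed.
Let Hi : inner_product D. Proof. by case: hD. Qed.

Lemma transversal_repr : { s : Gamma -> Gamma | forall t, T (s t) /\
  exists h : Lambda, t = (s t * val h)%g }.
Proof.
have /choice[s hs] : forall t, exists r, T r /\ exists h : Lambda, t = (r * val h)%g.
  by move=> t; have [r [h _]] := hT t; exists r.
by apply: (@exist _ _ s).
Qed.

Lemma transversal_uniq r r' (h h' : Lambda) : T r -> T r' ->
  (r * val h = r' * val h')%g -> r = r'.
Proof.
move=> Tr Tr' e; have [s [_ us]] := hT (r * val h)%g.
rewrite -(us r); last by split=> //; exists h.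
by apply: us; split=> //; exists h'.
Qed.

(** For [a] constant on cosets, [a (g * r)] depends only on the representative [s (g * r)] of the
    coset, and [r |-> s (g * r)] is a bijection of [T] with inverse [r |-> s (g^-1 * r)]. *)
Lemma esum_translate (g : Gamma) (a : Gamma -> \bar R) :
  (forall t (h : Lambda), a (t * val h)%g = a t) ->
  (\esum_(r in T) a (g * r)%g = \esum_(r in T) a r)%E.
Proof.
move=> ah; have [s hs] := transversal_repr.
rewrite [RHS](reindex_esum T T (fun r => s (g * r)%g)).
  apply: eq_esum => r Tr; have [_ [h]] := hs (g * r)%g.
  by move=> {1}->; rewrite ah.
split.
- by move=> r Tr /=; have [] := hs (g * r)%g.
- move=> r r' /set_mem Tr /set_mem Tr' e.
  have [_ [h e1]] := hs (g * r)%g; have [_ [h' e2]] := hs (g * r')%g.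
  have [k] : exists k : Lambda, (r = r' * val k)%g.
    exists (h'^-1 * h)%g; rewrite -[RHS](mulKg g) -[LHS](mulKg g).
    move: e1 e2; rewrite -e; move: (s _) => b e1 e2.
    by congr (_ * _)%g; rewrite [RHS]mulgA e2 e1 valM gmulfV mulgA mulgK.
  by move=> rk; apply: (@transversal_uniq _ _ 1%g k) => //; rewrite val1 mulg1.
- move=> r Tr; have [Ts [h e]] := hs (g^-1 * r)%g.
  exists (s (g^-1 * r)%g) => //.
  have [Ts' [h' e']] := hs (g * s (g^-1 * r))%g.
  apply: (@transversal_uniq _ _ (h' * h)%g 1%g) => //.
  by rewrite valM mulgA -e' -mulgA -e mulVKg val1 mulg1.
Qed.

Lemma ind_dom xi t : @dom _ Ind xi -> @dom _ D (xi t).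
Proof. by case. Qed.

Lemma ind_cov xi t (h : Lambda) : @dom _ Ind xi ->
  veq (xi (t * val h)%g) (rep_pi h^-1%g (xi t)).
Proof. by case. Qed.

Lemma unitaryD (g : Lambda) : unitary_operator (@rep_pi _ _ _ D g).
Proof. by case: uD. Qed.

Lemma boundedD (g : Lambda) : bounded_operator (@rep_pi _ _ _ D g).
Proof. by case: (unitaryD g). Qed.

Lemma dom_piD (g : Lambda) (x : D) : dom x -> dom (rep_pi g x).
Proof. by case: (boundedD g) => + _ _; apply. Qed.

Lemma ind_nsq_shift xi t (h : Lambda) : @dom _ Ind xi ->
  nsq (xi (t * val h)%g) = nsq (xi t).
Proof.
move=> dxi; have d1 := ind_dom t dxi; have d2 := ind_dom (t * val h)%g dxi.
rewrite (nsq_veq Hs Hi d2 (dom_piD _ d1) (ind_cov t h dxi)).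
exact: unitary_nsq (unitaryD _) d1.
Qed.

(** The squared norm of the induced space before [fine] is applied, so that its finiteness can still
    be stated as a condition. *)
Definition ind_nsq (xi : Gamma -> D) := (\esum_(r in T) (nsq (xi r))%:E)%E.

Lemma ind_domP xi : @dom _ Ind xi <->
  [/\ forall t, @dom _ D (xi t),
      forall t (h : Lambda), veq (xi (t * val h)%g) (rep_pi h^-1%g (xi t))
    & (ind_nsq xi < +oo)%E].
Proof.
suff E : (forall t, @dom _ D (xi t)) ->
    ind_nsq xi = (\esum_(r in T) ((vnorm (xi r)) ^+ 2)%:E)%E.
  by split=> -[d c f]; split=> //; move: f; rewrite E.
by move=> d; apply: eq_esum => r _; rewrite vnorm_sq.
Qed.

Lemma ind_nsq_fin xi : @dom _ Ind xi -> (ind_nsq xi < +oo)%E.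
Proof. by move/ind_domP => []. Qed.

Lemma ind_subspace : subspace_dom Ind.
Proof.
split.
  apply/ind_domP; split => [t|t h|]; first exact: dom0 Hs.
  - apply: (veq_sym Hs Hi); [|exact: dom0 Hs|exact: bounded0 (boundedD _)].
    by apply: dom_piD; exact: dom0 Hs.
  - rewrite /ind_nsq esum1// => r _ /=.
    by rewrite /nsq (ip0l Hs Hi (dom0 Hs)).
move=> a x y dx dy.
have dxt t := ind_dom t dx; have dyt t := ind_dom t dy.
have d t : dom (a *: x t + y t) by exact: domZD.
apply/ind_domP; split => // [t h|].
  have dpx := dom_piD h^-1%g (dxt t); have dpy := dom_piD h^-1%g (dyt t).
  have dp := dom_piD h^-1%g (d t).
  apply: (veq_trans Hs Hi (y := a *: rep_pi h^-1%g (x t) + rep_pi h^-1%g (y t))) => //.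
  - exact: domZD.
  - exact: domZD.
  - apply: (@veqZD _ D Hs Hi a (x (t * val h)%g) _ (y (t * val h)%g)) => //.
    + exact: ind_cov.
    + exact: ind_cov.
  - apply: veq_sym => //; first exact: domZD.
    by case: (boundedD h^-1%g) => _ + _; apply.
apply: (@le_lt_trans _ _ (\esum_(r in T) ((2 * normc_sq a)%:E * (nsq (x r))%:E +
    2%:E * (nsq (y r))%:E))%E).
  apply: le_esum => r _; rewrite -!EFinM -EFinD lee_fin -mulrA -nsqZ//.
  by apply: nsqD_le => //; exact: domZ.
have c0 : 0 <= 2 * normc_sq a by rewrite mulr_ge0// addr_ge0// sqr_ge0.
have nx r : (0 <= (nsq (x r))%:E)%E by rewrite lee_fin nsq_ge0.
have ny r : (0 <= (nsq (y r))%:E)%E by rewrite lee_fin nsq_ge0.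
rewrite esumD; last 2 first.
- by move=> r _; rewrite mule_ge0.
- by move=> r _; rewrite mule_ge0.
rewrite !esumZ// lte_add_pinfty// lte_mul_pinfty//; exact: ind_nsq_fin.
Qed.

Lemma ind_csummable x y : @dom _ Ind x -> @dom _ Ind y ->
  csummable T (fun r => ip (x r) (y r)).
Proof.
move=> dx dy.
have dxt t := ind_dom t dx; have dyt t := ind_dom t dy.
have fin : (\esum_(r in T) (nsq (x r) + nsq (y r))%:E < +oo)%E.
  under eq_esum do rewrite EFinD.
  by rewrite esumD ?lte_add_pinfty ?ind_nsq_fin// => r _; rewrite lee_fin nsq_ge0.
split; apply: (summable_le fin) => r _.
- exact: normr_Re_ip_le.
- exact: normr_Im_ip_le.
Qed.

Lemma ind_ipE x : @dom _ Ind x -> @ip _ Ind x x = (fine (ind_nsq x))%:C%C.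
Proof.
move=> dx; rewrite -csum_real; last by move=> r _; exact/nsq_ge0/ind_dom.
by apply: eq_csum => r _; rewrite (ip_nsq Hi)//; exact: ind_dom.
Qed.

Lemma ind_nsqE x : @dom _ Ind x -> @nsq _ Ind x = fine (ind_nsq x).
Proof. by move=> dx; rewrite /nsq ind_ipE. Qed.

Lemma ind_nsq_ge0 x : @dom _ Ind x -> (0 <= ind_nsq x)%E.
Proof. by move=> dx; apply: esum_ge0 => r _; rewrite lee_fin nsq_ge0//; exact: ind_dom. Qed.

Lemma ind_nsq_fin_num x : @dom _ Ind x -> ind_nsq x \is a fin_num.
Proof. by move=> dx; rewrite ge0_fin_numE ?ind_nsq_ge0// ind_nsq_fin. Qed.

Lemma ind_inner_product : inner_product Ind.
Proof.
split.
- move=> a x y z dx dy dz; rewrite -csumZD; try exact: ind_csummable.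
  by apply: eq_csum => r _; rewrite -ipZDl//; exact: ind_dom.
- move=> x y dx dy; rewrite -csumJ.
  by apply: eq_csum => r _; rewrite -ipC//; exact: ind_dom.
- by move=> x dx; rewrite ind_ipE// lecR fine_ge0// ind_nsq_ge0.
Qed.

Lemma ind_veq (x y : Ind) : (forall r, T r -> veq (x r) (y r)) -> veq x y.
Proof.
move=> xy; transitivity (csum T (fun=> (0 : R)%:C%C)).
  by apply: eq_csum => r Tr; exact: xy.
by rewrite csum_real// esum1.
Qed.

(** Evaluation is a contraction at every [t], also outside [T], because the fiber norm at [t] is the
    one at its coset representative. Cauchy sequences are therefore Cauchy in every fiber. *)
Lemma nsq_le_ind x t : @dom _ Ind x -> nsq (x t) <= @nsq _ Ind x.
Proof.
move=> dx; have [s hs] := transversal_repr; have [Ts [h ->]] := hs t.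
rewrite ind_nsq_shift// ind_nsqE// -lee_fin fineK ?ind_nsq_fin_num//.
apply: esum_ge; exists [set s t].
  by split; [exact: finite_set1|move=> _ ->].
by rewrite fsbig_set1.
Qed.

(* The limit is taken fiberwise, and [nsq_tri] bounds each finite partial sum of
   the tail without appealing to continuity of the norm. *)
Lemma ind_complete : complete_space Ind.
Proof.
apply/complete_spaceP => u du uC.
have dut n t : dom (u n t) := ind_dom t (du n).
have duB m n : @dom _ Ind (u m - u n) := domB ind_subspace (du m) (du n).
have /choice[l hl] : forall t, exists l, @dom _ D l /\ nsq_cvg (u ^~ t) l.
  move=> t; have /complete_spaceP cD : complete_space D by case: hD.
  have [//||l dl ul] := cD (u ^~ t); last by exists l.
  move=> e e0; have [N hN] := uC e e0; exists N => m n Nm Nn.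
  by rewrite (le_lt_trans _ (hN m n Nm Nn))// (nsq_le_ind t (duB m n)).
have dl t : dom (l t) by have [] := hl t.
have ul t : nsq_cvg (u ^~ t) (l t) by have [] := hl t.
have lc t (h : Lambda) : veq (l (t * val h)%g) (rep_pi h^-1%g (l t)).
  have dpl := dom_piD h^-1%g (dl t).
  apply/veqP => //; apply: nsq_small => //; first exact: domB.
  (* Quarters, because [nsq_tri] doubles each of the two errors. *)
  move=> e e0; have e4 : 0 < e / 4 by rewrite divr_gt0.
  have [N1 h1] := ul (t * val h)%g _ e4; have [N2 h2] := ul t _ e4.
  pose n := maxn N1 N2.
  have {}h1 := h1 n (leq_maxl _ _); have {}h2 := h2 n (leq_maxr _ _).
  rewrite (le_trans (nsq_tri Hs Hi (dl _) (dut n (t * val h)%g) dpl))//.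
  have dpu := dom_piD h^-1%g (dut n t).
  (* The unitary [rep_pi h^-1] carries the distance from [u n t] to [l t] over to the translated
     fiber, up to null vectors. *)
  have <- : nsq (u n t - l t) = nsq (u n (t * val h)%g - rep_pi h^-1%g (l t)).
    rewrite -(unitary_nsq (unitaryD h^-1%g)); last exact: domB.
    apply: (nsq_veq Hs Hi).
    - by apply: dom_piD; exact: domB.
    - exact: domB.
    apply: (veq_trans Hs Hi (y := rep_pi h^-1%g (u n t) - rep_pi h^-1%g (l t))).
    - by apply: dom_piD; exact: domB.
    - exact: domB.
    - exact: domB.
    - exact: (bounded_veqB (boundedD _)).
    - apply: veqB => //; last exact: (veq_refl Hs Hi).
      by apply: veq_sym => //; exact: ind_cov.
  by rewrite (nsqBC Hs Hi (dl _) (dut _ _)); lra.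
have fs (s : seq Gamma) (e : R) : 0 < e -> exists N : nat, forall n : nat,
    (N <= n)%N -> \sum_(r <- s) nsq (u n r - l r) <= e.
  elim: s e => [e e0|t s IH e e0]; first by exists 0%N => n _; rewrite big_nil ltW.
  have e2 : 0 < e / 2 by rewrite divr_gt0.
  have [N1 h1] := IH _ e2; have [N2 h2] := ul t _ e2.
  exists (maxn N1 N2) => n; rewrite geq_max => /andP[/h1 {}h1 /h2 {}h2].
  by rewrite big_cons [leRHS](splitr e) lerD// ltW.
have tail e : 0 < e -> exists N : nat, forall m : nat, (N <= m)%N ->
    (ind_nsq (u m - l)%R <= e%:E)%E.
  move=> e0; have e4 : 0 < e / 4 by rewrite divr_gt0.
  have [N hN] := uC _ e4; exists N => m Nm.
  apply: ge_ereal_sup => _ [Y [finY YT] <-].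
  rewrite fsbig_finite//= sumEFin lee_fin.
  have [N' hN'] := fs (finmap.enum_fset (fset_set Y)) _ e4.
  (* [N'] depends on the finite set [Y], but [n] disappears from the final bound while [N] does not
     depend on [Y]; hence the supremum over [Y] can be taken. *)
  pose n := maxn N N'.
  have Yn := hN' n (leq_maxr _ _); have Nn := hN m n Nm (leq_maxl _ _).
  apply: (@le_trans _ _ (\sum_(r <- finmap.enum_fset (fset_set Y))
    (2 * nsq (u m r - u n r) + 2 * nsq (u n r - l r)))).
    by apply: ler_sum => r _; exact: nsq_tri.
  rewrite big_split/= -!mulr_sumr.
  have : \sum_(r <- finmap.enum_fset (fset_set Y)) nsq (u m r - u n r) <= @nsq _ Ind (u m - u n).
    rewrite ind_nsqE// -lee_fin fineK ?ind_nsq_fin_num//.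
    apply: esum_ge; exists Y => //.
    by rewrite fsbig_finite//= sumEFin.
  by move=> ?; lra.
(* Finiteness comes from [l = (l - u N) + u N], whose first term is controlled by [tail]. *)
have dlI : @dom _ Ind l.
  apply/ind_domP; split => //.
  have [N /(_ N (leqnn _)) hN] := tail 1 ltr01.
  apply: (@le_lt_trans _ _ (\esum_(r in T) (2%:E * (nsq (u N r - l r))%:E +
      2%:E * (nsq (u N r))%:E))%E).
    apply: le_esum => r _; rewrite -!EFinM -EFinD lee_fin (nsqBC Hs Hi)//.
    rewrite -{1}(subrK (u N r) (l r)); apply: nsqD_le => //.
    exact: domB.
  have n1 r : (0 <= (nsq (u N r - l r))%:E)%E.
    by rewrite lee_fin nsq_ge0//; exact: domB.
  have n2 r : (0 <= (nsq (u N r))%:E)%E by rewrite lee_fin nsq_ge0.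
  rewrite esumD; last 2 first.
  - by move=> r _; rewrite mule_ge0.
  - by move=> r _; rewrite mule_ge0.
  rewrite !esumZ// lte_add_pinfty// lte_mul_pinfty//.
  - by rewrite (le_lt_trans hN)// ltry.
  - exact: ind_nsq_fin.
exists l => // e e0; have e2 : 0 < e / 2 by rewrite divr_gt0.
have [N hN] := tail _ e2; exists N => n Nn.
have duB' := domB ind_subspace (du n) dlI.
rewrite ind_nsqE// (@le_lt_trans _ _ (e / 2))//; last by lra.
by rewrite -lee_fin fineK ?hN ?ind_nsq_fin_num.
Qed.

Lemma ind_hilbert : hilbert Ind.
Proof. split; [exact: ind_subspace|exact: ind_inner_product|exact: ind_complete]. Qed.

Lemma ind_pi_dom g (x : Ind) : dom x -> dom (rep_pi g x).
Proof.
move=> dx; apply/ind_domP; split => /= [t|t h|]; first exact: ind_dom.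
- by rewrite mulgA; exact: ind_cov.
- rewrite /ind_nsq (esum_translate g^-1%g (a := fun t => (nsq (x t))%:E)).
    exact: ind_nsq_fin.
  by move=> t h; rewrite ind_nsq_shift.
Qed.

Lemma ind_unitary : unitary_representation Ind.
Proof.
have Is := ind_subspace; have Ii := ind_inner_product.
split.
- move=> g; apply: isometry_unitary => //.
  + exact: ind_pi_dom.
  + by move=> a x y dx dy; exact: veq_refl.
  + move=> x dx; rewrite !ind_nsqE//; last exact: ind_pi_dom.
    rewrite /ind_nsq (esum_translate g^-1%g (a := fun t => (nsq (x t))%:E))//.
    by move=> t h; rewrite ind_nsq_shift.
  + move=> y dy; exists (rep_pi g^-1%g y); first exact: ind_pi_dom.
    rewrite (_ : rep_pi g _ = y); first exact: veq_refl.
    by apply/funext => t /=; rewrite invgK mulVKg.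
- move=> x dx; rewrite (_ : rep_pi _ x = x); first exact: veq_refl.
  by apply/funext => t /=; rewrite invg1 mul1g.
- move=> g h x dx; rewrite (_ : rep_pi _ x = rep_pi g (rep_pi h x)).
    exact: veq_refl.
  by apply/funext => t /=; rewrite invgM mulgA.
Qed.

End induction.

(** * Continuous complex functions on a compact space *)

Section continuous_functions.
Variables (R : realType) (X : topologicalType).
Implicit Types f : X -> R[i].

Lemma normc_ge_Im (z : R[i]) : `|complex.Im z|%:C%C <= `|z|.
Proof.
by rewrite normc_def lecR -sqrtr_sqr ler_wsqrtr// lerDr sqr_ge0.
Qed.

Lemma CX_Re_Im f : CX f ->
  continuous (fun x => complex.Re (f x)) /\ continuous (fun x => complex.Im (f x)).
Proof.
move=> cf.
have near_f x (e : R) : 0 < e -> \forall y \near x, `|f x - f y| < e%:C%C.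
  move=> e0; have e0' : 0 < e%:C%C :> R[i] by rewrite ltcR.
  by have /cvgrPdist_lt/(_ _ e0') := cf x.
split=> x; apply/cvgrPdist_lt => e e0; near=> y.
- rewrite -raddfB -ltcR (le_lt_trans (normc_ge_Re _))//.
  by near: y; exact: near_f.
- rewrite -raddfB -ltcR (le_lt_trans (normc_ge_Im _))//.
  by near: y; exact: near_f.
Unshelve. all: by end_near. Qed.

Lemma CX_bounded f : compact [set: X] -> CX f ->
  exists M : R, forall x, normc_sq (f x) <= M.
Proof.
move=> cX /CX_Re_Im[cr ci].
have bd (g : X -> R) : continuous g -> exists M : R, forall x, `|g x| <= M.
  move=> cg; have /continuous_compact : {within [set: X], continuous g}.
    exact: continuous_subspaceT.
  move=> /(_ cX) /compact_bounded [M [_ hM]].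
  by exists (M + 1) => x; apply: hM; [rewrite ltrDl|exists x].
have [M1 h1] := bd _ cr; have [M2 h2] := bd _ ci.
exists (M1 ^+ 2 + M2 ^+ 2) => x; rewrite /normc_sq.
have [r1 i2] := (h1 x, h2 x).
rewrite lerD// -real_normK ?num_real// lerXn2r ?nnegrE//.
- exact: le_trans (normr_ge0 _) r1.
- exact: le_trans (normr_ge0 _) i2.
Qed.

End continuous_functions.

(** * Continuous actions and translates of functions *)

Section actions.
Variables (R : realType) (Gamma : groupType) (X : topologicalType).
Variable act : Gamma -> X -> X.
Hypothesis cact : continuous_action act.
Implicit Types f : X -> R[i].

Lemma CX_fun_act g f : CX f -> CX (fun_act act g f).
Proof.
case: cact => _ _ ca cf x; apply: continuous_comp; first exact: ca.
exact: cf.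
Qed.

Lemma fun_actM g h f : fun_act act (g * h)%g f = fun_act act g (fun_act act h f).
Proof. by case: cact => _ aM _; apply/funext => x; rewrite /fun_act invgM aM. Qed.

Lemma actK g : cancel (act g) (act g^-1%g).
Proof. by case: cact => a1 aM _ x; rewrite -aM mulVg a1. Qed.

Lemma actVK g : cancel (act g^-1%g) (act g).
Proof. by case: cact => a1 aM _ x; rewrite -aM mulgV a1. Qed.

End actions.

Lemma valVg (Gamma : groupType) (P : pred Gamma) (Lambda : subGroupType P)
  (h : Lambda) : val h^-1%g = (val h)^-1%g.
Proof. exact: gmulfV. Qed.

Lemma restrict_action (Gamma : groupType) (P : pred Gamma)
    (Lambda : subGroupType P) (X : topologicalType) (act : Gamma -> X -> X) :
  continuous_action act -> continuous_action (fun h : Lambda => act (val h)).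
Proof.
by case=> a1 aM ac; split => [x|g h x|g]; rewrite ?val1 ?valM//; exact: ac.
Qed.

(** * Induction of covariant representations *)

Section induced_covariant.
Variables (R : realType) (Gamma : groupType) (P : pred Gamma).
Variables (Lambda : subGroupType P) (T : set Gamma) (X : topologicalType).
Variables (act : Gamma -> X -> X) (D : rep_data R Lambda X).
Hypothesis hT : left_transversal Lambda T.
Hypothesis cX : compact [set: X].
Hypothesis cact : continuous_action act.
Hypothesis covD : covariant_rep (fun h : Lambda => act (val h)) D.
(** Boundedness of each [rep_rho f] would give every translate [r^-1 . f] its own constant. The
    induced operator needs one constant for all fibers, and a bound on the values of [f] is the same
    for all its translates. *)
Hypothesis contrD : forall f (M : R), CX f -> (forall x, normc_sq (f x) <= M) ->
  forall x : D, dom x -> nsq (rep_rho f x) <= M * nsq x.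

Let Ind := induced_rep T act D.
Let hD : hilbert D. Proof. by case: covD. Qed.
Let uD : unitary_representation D. Proof. by case: covD. Qed.
Let sD : star_rep D. Proof. by case: covD. Qed.
Let Hs : subspace_dom D. Proof. by case: hD. Qed.
Let Hi : inner_product D. Proof. by case: hD. Qed.

Lemma dom_rhoD f (x : D) : CX f -> dom x -> dom (rep_rho f x).
Proof. by case: sD => b _ cf; case: (b _ cf) => + _ _; apply. Qed.

Lemma fun_act_sub (k : Lambda) (f : X -> R[i]) :
  fun_act (fun h : Lambda => act (val h)) k f = fun_act act (val k) f.
Proof. by rewrite /fun_act valVg. Qed.

Lemma rep_piVK (k : Lambda) (x : D) : dom x ->
  veq (rep_pi k^-1%g (rep_pi k x)) x.
Proof.
case: uD => _ u1 uM dx; have dp k' := dom_piD uD k'.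
apply: (veq_trans Hs Hi (y := rep_pi 1%g x)); [exact/dp/dp|exact: dp|exact: dx| |exact: u1].
rewrite -(mulVg k); apply: (veq_sym Hs Hi); [exact: dp|exact/dp/dp|exact: uM].
Qed.

(* [rho (h^-1 . f) (sigma h^-1 x)] is [sigma h^-1 (rho f x)] by covariance,
   which is the compatibility of [Ind rho f] with right translation. *)
Lemma ind_rho_dom f (x : Gamma -> D) : CX f -> @dom _ Ind x ->
  @dom _ Ind (@rep_rho _ _ _ Ind f x).
Proof.
move=> cf dx; have cft t : CX (fun_act act t f) := CX_fun_act cact (g := t) cf.
have dxt t : @dom _ D (x t) := ind_dom t dx.
have d t : @dom _ D (@rep_rho _ _ _ D (fun_act act t^-1%g f) (x t)).
  exact: (dom_rhoD (cft _) (dxt t)).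
have [_ i] := ind_domP (T := T) (act := act) hD (@rep_rho _ _ _ Ind f x); apply: i.
split; [exact: d|move=> t h|].
  have bpi k := boundedD uD k; have dpi k := dom_piD uD k.
  have dxh := dpi h^-1%g _ (dxt t).
  have ch : CX (fun_act act (t * val h)^-1%g f) by exact: cft.
  have brho := sD.1 _ ch.
  have e1 : veq (rep_rho (fun_act act (t * val h)^-1%g f) (x (t * val h)%g))
                (rep_rho (fun_act act (t * val h)^-1%g f) (rep_pi h^-1%g (x t))).
    exact: (bounded_veq Hs Hi brho (dxt _) dxh (ind_cov t h dx)).
  have dF := d t; set F := fun_act act t^-1%g f in dF *.
  have dh : dom (rep_pi h^-1%g (rep_rho F (x t))) := dpi h^-1%g _ dF.
  have dz := dom_rhoD ch dxh; have dxth := d (t * val h)%g.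
  apply: (veq_trans Hs Hi dxth dz dh e1).
  have [_ _ _ /(_ h^-1%g F _ (cft _) dxh)] := covD.
  rewrite fun_act_sub valVg -fun_actM// -invgM.
  have dhh := dpi h^-1%g^-1%g _ dxh; have dFh := dom_rhoD (cft t^-1%g) dhh.
  have dl := dpi h^-1%g _ dFh => e2.
  apply: (veq_trans Hs Hi dz dl dh); first exact: (veq_sym Hs Hi dl dz e2).
  apply: (bounded_veq Hs Hi (bpi _) dFh dF).
  apply: (bounded_veq Hs Hi (sD.1 _ (cft _)) dhh (dxt t)).
  exact: rep_piVK.
have [M hM] := CX_bounded cX cf.
apply: (@le_lt_trans _ _ (\esum_(r in T) (`|M|%:E * (nsq (x r))%:E))%E).
  apply: le_esum => r _; rewrite -EFinM lee_fin.
  exact: (contrD (cft _) (fun y => le_trans (hM _) (ler_norm M)) (dxt r)).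
rewrite esumZ// ?lte_mul_pinfty//.
- exact: (ind_nsq_fin hD dx).
- by move=> r; rewrite lee_fin nsq_ge0.
Qed.

Lemma ind_rho_bounded f : CX f -> bounded_operator (@rep_rho _ _ _ Ind f).
Proof.
move=> cf; have cft t : CX (fun_act act t f) := CX_fun_act cact (g := t) cf.
have Is := ind_subspace T act hD uD; have Ii := ind_inner_product T act hD.
have [M hM] := CX_bounded cX cf.
apply: (@bounded_operator_sq _ Ind Ii _ `|M|).
- by move=> x dx; exact: (ind_rho_dom cf dx).
- move=> a x y dx dy; apply: ind_veq => r _.
  have [_ lin _] := sD.1 _ (cft r^-1%g).
  exact: (lin a _ _ (ind_dom r dx) (ind_dom r dy)).
- move=> x dx; have dfx := ind_rho_dom cf dx.
  rewrite (ind_nsqE hD dfx) (ind_nsqE hD dx).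
  have fx := ind_nsq_fin_num hD dx; have ffx := ind_nsq_fin_num hD dfx.
  rewrite -lee_fin EFinM !fineK//.
  rewrite /ind_nsq -esumZ//; last by move=> r; rewrite lee_fin nsq_ge0//; exact: (ind_dom r dx).
  apply: le_esum => r _; rewrite -EFinM lee_fin.
  exact: (contrD (cft _) (fun y => le_trans (hM _) (ler_norm M)) (ind_dom r dx)).
Qed.

Lemma ind_star_rep : star_rep Ind.
Proof.
have cft t (f : X -> R[i]) : CX f -> CX (fun_act act t f) by exact: CX_fun_act.
have [_ [sl sm s1 sJ]] := sD.
split; first exact: ind_rho_bounded.
split.
- move=> a f1 f2 x c1 c2 dx; apply: ind_veq => r _.
  exact: (sl a _ _ _ (cft r^-1%g _ c1) (cft r^-1%g _ c2) (ind_dom r dx)).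
- move=> f1 f2 x c1 c2 dx; apply: ind_veq => r _.
  exact: (sm _ _ _ (cft r^-1%g _ c1) (cft r^-1%g _ c2) (ind_dom r dx)).
- by move=> x dx; apply: ind_veq => r _; exact: (s1 _ (ind_dom r dx)).
- move=> f x y cf dx dy; apply: eq_csum => r _.
  exact: (sJ _ _ _ (cft r^-1%g _ cf) (ind_dom r dx) (ind_dom r dy)).
Qed.

Lemma ind_covariant_rep : covariant_rep act Ind.
Proof.
split.
- exact: (ind_hilbert _ hT hD uD).
- exact: (ind_unitary _ hT hD uD).
- exact: ind_star_rep.
- move=> g f x cf dx; apply: ind_veq => r _ /=.
  (* At [r], covariance reduces to the identity [(g^-1 r)^-1 . f = r^-1 . (g . f)] of functions. *)
  have -> : fun_act act (g^-1 * r)^-1%g f = fun_act act r^-1%g (fun_act act g f).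
    by rewrite invgM invgK (fun_actM cact).
  rewrite invgK mulVKg; exact: (veq_refl Hs Hi).
Qed.

End induced_covariant.

(** * Completeness of L^2 *)

Lemma cvg_geometric_increments (R : realType) (w : R^nat) (C : R) :
  (forall k, `|w k.+1 - w k| <= C * 2^-1 ^+ k) -> cvgn w.
Proof.
move=> hw.
have C0 : 0 <= C by have := le_trans (normr_ge0 _) (hw 0%N); rewrite expr0 mulr1.
have : cvgn (series (telescope w)).
  apply: normed_cvg; apply: (@series_le_cvg _ _ (geometric C 2^-1)).
  - by move=> n; exact: normr_ge0.
  - by move=> n; rewrite /geometric/= mulr_ge0// exprn_ge0.
  - exact: hw.
  - by apply: is_cvg_geometric_series; rewrite ger0_norm// invf_lt1// ltr1n.
move=> cw; have -> : w = (fun n => w 0%N + series (telescope w) n).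
  by apply/funext => n; exact: eq_sum_telescope.
by apply: is_cvgD => //; exact: is_cvg_cst.
Qed.

Section riesz_fischer.
Context d (T : measurableType d) (R : realType) (mu : {measure set T -> \bar R}).
Implicit Types f g : T -> R.

Definition sqn f : \bar R := (\int[mu]_x ((f x) ^+ 2)%:E)%E.

Lemma sqn_ge0 f : (0 <= sqn f)%E.
Proof. by apply: integral_ge0 => x _; rewrite lee_fin sqr_ge0. Qed.

Lemma measurable_sqr f : measurable_fun [set: T] f ->
  measurable_fun [set: T] (fun x => (f x ^+ 2)%:E).
Proof. by move=> mf; apply/measurable_EFinP; exact: measurable_funX. Qed.

Lemma measurable_sqrB f g : measurable_fun [set: T] f ->
  measurable_fun [set: T] g ->
  measurable_fun [set: T] (fun x => ((f x - g x) ^+ 2)%:E).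
Proof. by move=> mf mg; apply: (measurable_sqr (measurable_funB mf mg)). Qed.

(* A subsequence [v] is chosen so fast that [S = sum_k 4^k |v_(k+1) - v_k|^2] has
   finite integral; where [S] is finite, [v] has geometric increments.  Fatou's
   lemma then controls the distance of [u n] to the pointwise limit. *)
Lemma riesz_fischer (u : nat -> T -> R) :
  (forall n, measurable_fun [set: T] (u n)) ->
  (forall e : R, 0 < e -> exists N : nat, forall m n : nat,
    (N <= m)%N -> (N <= n)%N -> (sqn (u m \- u n)%R < e%:E)%E) ->
  exists2 l : T -> R, measurable_fun [set: T] l &
  forall e : R, 0 < e -> exists N : nat, forall n : nat,
    (N <= n)%N -> (sqn (u n \- l)%R <= e%:E)%E.
Proof.
move=> mu_ uC.
(* The factor [4^-k] cancels the weight [4^k] in [S]; the remaining [2^-(k+1)] makes the integrals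
   of the terms summable. *)
pose eps (k : nat) : R := (4^-1 ^+ k) / (2 ^ k.+1)%:R.
have eps0 k : 0 < eps k by rewrite divr_gt0// ?exprn_gt0 ?invr_gt0// ltr0n expn_gt0.
have /choice[N hN] : forall k, exists N : nat, forall m n : nat,
    (N <= m)%N -> (N <= n)%N -> (sqn (u m \- u n)%R < (eps k)%:E)%E.
  by move=> k; exact: uC.
(* Partial sums of [N] dominate every [N j] with [j <= k], so [v k] is in the range of validity of
   all earlier thresholds. *)
pose s k := (\sum_(j < k.+1) N j)%N.
have sN j k : (j <= k)%N -> (N j <= s k)%N.
  move=> jk; have jk1 : (j < k.+1)%N by rewrite ltnS.
  by rewrite /s (bigD1 (Ordinal jk1))//= leq_addr.
pose v k := u (s k).
have mv k : measurable_fun setT (v k) by exact: mu_.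
pose a k x := ((4 ^+ k)%:E * ((v k.+1 x - v k x) ^+ 2)%:E : \bar R)%E.
have ma k : measurable_fun setT (a k).
  by apply: emeasurable_funM => //; exact: measurable_sqrB.
have a0 k x : (0 <= a k x)%E by rewrite mule_ge0 ?lee_fin ?sqr_ge0// exprn_ge0.
pose S x := (\sum_(k <oo) a k x)%E.
have mS : measurable_fun setT S.
  have := @ge0_emeasurable_sum _ T R setT a xpredT (fun k x _ _ => a0 k x) (fun k _ => ma k).
  by [].
have S0 x : (0 <= S x)%E by exact: nneseries_ge0.
have iS : (\int[mu]_x S x < +oo)%E.
  rewrite integral_nneseries//.
  (* The summand is written in the shape required by [epsilon_trick], with zero terms and total
     error 1. *)
  apply: (@le_lt_trans _ _ (\sum_(k <oo) (0 + (1 / (2 ^ k.+1)%:R)%:E) : \bar R)%E).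
    apply: lee_nneseries => [*|k _]; first by apply: integral_ge0 => x _; exact: a0.
    rewrite add0e ge0_integralZl//; last 2 first.
    - exact: measurable_sqrB.
    - by move=> x _; rewrite lee_fin sqr_ge0.
    have : (sqn (v k.+1 \- v k)%R <= (eps k)%:E)%E.
      by apply/ltW/hN; apply: sN.
    have p4 : (0 < (4 ^+ k)%:E :> \bar R)%E by rewrite lte_fin exprn_gt0.
    rewrite -(@lee_pmul2l _ (4 ^+ k)%:E)//.
    move=> h; apply: (le_trans h).
    by rewrite -EFinM lee_fin /eps exprVn mulrA mulfV// expf_neq0.
  apply: le_lt_trans (epsilon_trick _ _ _) _ => //.
  by rewrite eseries0// add0e ltry.
pose E := [set x | (S x < +oo)%E].
have mE : measurable E by rewrite -[E]setTI; exact: emeasurable_fun_infty_o.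
have negE : mu.-negligible (~` E).
  have intS : mu.-integrable setT S.
    apply/integrableP; split=> //; rewrite (eq_integral S)// => x _.
    by rewrite gee0_abs.
  have := integrable_ae measurableT intS.
  apply: negligibleS => x /= nE /(_ I); rewrite ge0_fin_numE//.
have cvE x : E x -> cvgn (v ^~ x).
  move=> Ex; have Sf : S x \is a fin_num by rewrite ge0_fin_numE.
  (* From [4^k * |v k.+1 x - v k x|^2 <= S x], taking square roots gives the ratio [1/2] and this
     constant. *)
  apply: (@cvg_geometric_increments _ _ (Num.sqrt (fine (S x)))) => k.
  have : (a k x <= S x)%E.
    apply: (@le_trans _ _ (\sum_(0 <= j < k.+1) a j x)%E).
      by rewrite big_nat_recr//= leeDr// sume_ge0.
    exact: nneseries_lim_ge.
  rewrite /a -(fineK Sf) -EFinM lee_fin => Ck.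
  suff : `|v k.+1 x - v k x| ^+ 2 <= (Num.sqrt (fine (S x)) * 2^-1 ^+ k) ^+ 2.
    by rewrite ler_sqr// nnegrE ?mulr_ge0 ?sqrtr_ge0 ?exprn_ge0.
  rewrite exprMn sqr_sqrtr ?fine_ge0// real_normK ?num_real//.
  have -> : (2^-1 ^+ k) ^+ 2 = (4 ^+ k)^-1 :> R.
    rewrite -exprM mulnC exprM exprVn -[in RHS]exprVn; congr (_^-1 ^+ _).
    by rewrite -natrX.
  by rewrite ler_pdivlMr ?exprn_gt0// mulrC.
(* Cutting off outside [E] makes the sequence converge at every point, so the limit is measurable;
   only a null set is modified. *)
pose h k x := v k x * \1_E x.
have mh k : measurable_fun setT (h k) by exact: measurable_funM.
pose l x := limn (h ^~ x).
have hl x : h ^~ x @ \oo --> l x.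
  have [Ex|nEx] := pselect (E x).
    apply: cvgP; rewrite /h indicE mem_set//.
    by under eq_fun do rewrite mulr1; exact: cvE.
  apply: cvgP; rewrite /h indicE memNset//.
  by under eq_fun do rewrite mulr0; exact: is_cvg_cst.
have ml : measurable_fun setT l.
  exact: (measurable_realfun.measurable_fun_cvg mh (fun x _ => hl x)).
have tail j m : (N j <= m)%N -> (sqn (u m \- l)%R <= (eps j)%:E)%E.
  move=> Nm.
  have e1 k : (j <= k)%N -> (\int[mu]_x ((u m x - h k x) ^+ 2)%:E <= (eps j)%:E)%E.
    move=> jk; rewrite (ge0_ae_eq_integral (g := fun x => ((u m x - v k x) ^+ 2)%:E))//.
    - exact/ltW/hN/sN.
    - exact: measurable_sqrB.
    - exact: measurable_sqrB.
    - by move=> x _; rewrite lee_fin sqr_ge0.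
    - by move=> x _; rewrite lee_fin sqr_ge0.
    - apply: negligibleS negE => x /= nx Ex; apply: nx => _.
      by rewrite /h indicE mem_set// mulr1.
  have cvl x : ((u m x - h k x) ^+ 2)%:E @[k --> \oo] --> ((u m x - l x) ^+ 2)%:E.
    apply: cvg_EFin; first by near=> k.
    apply: (@cvg_comp _ _ _ (fun k => u m x - h k x) (fun y => y ^+ 2) _ (nbhs (u m x - l x))).
      by apply: cvgB; [exact: cvg_cst|exact: hl].
    exact: exprn_continuous.
  have := @fatou _ _ _ mu _ measurableT (fun k x => ((u m x - h k x) ^+ 2)%:E).
  rewrite /sqn; under eq_integral => x _ do rewrite (cvg_limn_einf_sup (cvl x)).1.
  move=> F; apply: le_trans (F _ _) _.
  - by move=> k; apply: measurable_sqr; exact: measurable_funB.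
  - by move=> k x _; rewrite lee_fin sqr_ge0.
  rewrite limn_einf_lim; apply: lime_le; first exact: is_cvg_einfs.
  (* The infimum over indices from [k] on is at most the value at [maxn j k], an index large enough
     for [e1] as well. *)
  near=> k; apply: (@le_trans _ _ (\int[mu]_x ((u m x - h (maxn j k) x) ^+ 2)%:E)%E).
    apply: ereal_inf_lbound; exists (maxn j k) => //=; exact: leq_maxr.
  by apply: e1; exact: leq_maxl.
exists l => // e e0.
(* Indeed [eps k <= 2^-(k+1) <= 1/(k+1)]. *)
have [j hj] : exists j, eps j <= e.
  have [k hk] := ltr_add_invr e0.
  exists k; apply: le_trans (ltW hk); rewrite add0r /eps.
  rewrite -[leRHS]mul1r ler_pM ?exprn_ge0 ?invr_ge0//.
  - by rewrite exprn_ile1// invf_le1// ler1n.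
  - rewrite lef_pV2 ?posrE ?ltr0n ?expn_gt0// ler_nat.
    exact/ltnW/ltn_expl.
by exists (N j) => n /tail h1; apply: (le_trans h1); rewrite lee_fin.
Unshelve. all: by end_near. Qed.

End riesz_fischer.

(** * The Hilbert space of complex square-integrable functions *)

Section complex_L2.
Variables (R : realType) (X : ptopologicalType).
Variable nu : {measure set (borel X) -> \bar R}.
Implicit Types (f g : X -> R[i]) (F G : X -> R[i]).

Definition re f : borel X -> R := fun x => complex.Re (f x).
Definition im f : borel X -> R := fun x => complex.Im (f x).

Definition cmeasurable f :=
  measurable_fun [set: borel X] (re f) /\ measurable_fun [set: borel X] (im f).

Definition cintegrable f :=
  nu.-integrable [set: borel X] (EFin \o re f) /\
  nu.-integrable [set: borel X] (EFin \o im f).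

Definition L2sq f : \bar R := (\int[nu]_(x in [set: borel X]) (normc_sq (f x))%:E)%E.

Lemma normc_sq_ge0 (z : R[i]) : 0 <= normc_sq z.
Proof. by rewrite addr_ge0// sqr_ge0. Qed.

Lemma normc_sqM (z w : R[i]) : normc_sq (z * w) = normc_sq z * normc_sq w.
Proof. by case: z w => [a b] [c d]; rewrite /normc_sq/=; ring. Qed.

Lemma normc_sqD_le (z w : R[i]) :
  normc_sq (z + w) <= 2 * normc_sq z + 2 * normc_sq w.
Proof.
case: z w => [a b] [c d]; rewrite /normc_sq/= -subr_ge0.
have -> : 2 * (a ^+ 2 + b ^+ 2) + 2 * (c ^+ 2 + d ^+ 2) - ((a + c) ^+ 2 + (b + d) ^+ 2)
  = (a - c) ^+ 2 + (b - d) ^+ 2 by ring.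
by rewrite addr_ge0// sqr_ge0.
Qed.

Lemma L2sq_ge0 f : (0 <= L2sq f)%E.
Proof. by apply: integral_ge0 => x _; rewrite lee_fin normc_sq_ge0. Qed.

Lemma measurable_normc_sq f : cmeasurable f ->
  measurable_fun [set: borel X] (fun x : borel X => (normc_sq (f x))%:E).
Proof.
move=> [mr mi]; apply/measurable_EFinP.
by apply: measurable_funD; exact: measurable_funX.
Qed.

Lemma L2sqE f : cmeasurable f -> L2sq f = (sqn nu (re f) + sqn nu (im f))%E.
Proof.
move=> [mr mi]; rewrite /sqn -ge0_integralD//.
- by move=> x _; rewrite lee_fin sqr_ge0.
- exact: measurable_sqr.
- by move=> x _; rewrite lee_fin sqr_ge0.
- exact: measurable_sqr.
Qed.

Lemma square_integrableP f :
  square_integrable nu f <-> cmeasurable f /\ (L2sq f < +oo)%E.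
Proof. by split=> [[? ? ?]|[[? ?] ?]]. Qed.

Lemma L2sq_fin f : square_integrable nu f -> L2sq f \is a fin_num.
Proof. by move/square_integrableP => [_ h]; rewrite ge0_fin_numE// L2sq_ge0. Qed.

Lemma cmeasurableZD (a : R[i]) f g : cmeasurable f -> cmeasurable g ->
  cmeasurable (fun x => a * f x + g x).
Proof.
move=> [rf jf] [rg jg]; case: a => u v.
have mZ (c : R) (h : borel X -> R) : measurable_fun setT h ->
  measurable_fun setT (fun x => c * h x) by exact: measurable_funM.
split.
- rewrite (_ : re _ = fun x => u * re f x - v * im f x + re g x).
    by apply: measurable_funD => //; apply: measurable_funB; exact: mZ.
  by apply/funext => x; rewrite /re /im; case: (f x) (g x) => [? ?] [? ?].
- rewrite (_ : im _ = fun x => u * im f x + v * re f x + im g x).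
    by apply: measurable_funD => //; apply: measurable_funD; exact: mZ.
  by apply/funext => x; rewrite /re /im; case: (f x) (g x) => [? ?] [? ?].
Qed.

Lemma cmeasurableM f g : cmeasurable f -> cmeasurable g ->
  cmeasurable (fun x => f x * g x).
Proof.
move=> [rf jf] [rg jg]; split.
- rewrite (_ : re _ = fun x => re f x * re g x - im f x * im g x).
    by apply: measurable_funB; exact: measurable_funM.
  by apply/funext => x; rewrite /re /im; case: (f x) (g x) => [? ?] [? ?].
- rewrite (_ : im _ = fun x => re f x * im g x + im f x * re g x).
    by apply: measurable_funD; exact: measurable_funM.
  by apply/funext => x; rewrite /re /im; case: (f x) (g x) => [? ?] [? ?].
Qed.

Lemma cmeasurableJ f : cmeasurable f -> cmeasurable (fun x => (f x)^*%C).
Proof.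
move=> [rf jf]; split.
- rewrite (_ : re _ = re f)//.
  by apply/funext => x; rewrite /re; case: (f x).
- rewrite (_ : im _ = fun x => - im f x).
    exact: measurableT_comp.
  by apply/funext => x; rewrite /im; case: (f x).
Qed.

Lemma integrable_L2sq f : square_integrable nu f ->
  nu.-integrable [set: borel X] (EFin \o (fun x : borel X => normc_sq (f x))).
Proof.
move/square_integrableP => [mf ff]; apply/integrableP; split.
  exact: measurable_normc_sq.
by under eq_integral => x _ do rewrite /= ger0_norm ?normc_sq_ge0//.
Qed.

(** The real and imaginary parts of [z * w^*] are bounded by [|z|^2 + |w|^2], by expanding squares
    of sums and differences of coordinates. *)
Lemma square_integrable_mul f g : square_integrable nu f ->
  square_integrable nu g -> cintegrable (fun x => f x * (g x)^*%C).
Proof.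
move=> hf hg; have /square_integrableP[mf _] := hf.
have /square_integrableP[mg _] := hg.
have [mr mi] := cmeasurableM mf (cmeasurableJ mg).
have ib := integrableD measurableT (integrable_L2sq hf) (integrable_L2sq hg).
have bnd (z w : R[i]) : `|complex.Re (z * w^*%C)| <= normc_sq z + normc_sq w /\
    `|complex.Im (z * w^*%C)| <= normc_sq z + normc_sq w.
  case: z w => [a b] [c d]; rewrite /normc_sq/= !ler_norml.
  have := (sqr_ge0 (a + c), sqr_ge0 (a - c), sqr_ge0 (b + d), sqr_ge0 (b - d)).
  have := (sqr_ge0 (a + d), sqr_ge0 (a - d), sqr_ge0 (b + c), sqr_ge0 (b - c)).
  rewrite !sqrrD !sqrrN => -[[[? ?] ?] ?] [[[? ?] ?] ?].
  by have := (sqr_ge0 a, sqr_ge0 b, sqr_ge0 c, sqr_ge0 d) => -[[[? ?] ?] ?];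
    split; apply/andP; split; lra.
split; apply: (le_integrable measurableT _ _ ib).
- exact/measurable_EFinP.
- move=> x _; rewrite /= lee_fin [leRHS]ger0_norm ?addr_ge0 ?sqr_ge0//.
  exact: (bnd (f x) (g x)).1.
- exact/measurable_EFinP.
- move=> x _; rewrite /= lee_fin [leRHS]ger0_norm ?addr_ge0 ?sqr_ge0//.
  exact: (bnd (f x) (g x)).2.
Qed.

Lemma cintegralZD (a : R[i]) F G : cintegrable F -> cintegrable G ->
  cintegral nu (fun x => a * F x + G x) = a * cintegral nu F + cintegral nu G.
Proof.
move=> [rF jF] [rG jG]; case: a => u v.
have lin (c e : R) (p q r : borel X -> R) :
    nu.-integrable setT (EFin \o p) -> nu.-integrable setT (EFin \o q) ->
    nu.-integrable setT (EFin \o r) ->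
    \int[nu]_x (c * p x + e * q x + r x) =
    c * (\int[nu]_x p x) + e * (\int[nu]_x q x) + \int[nu]_x r x.
  move=> ip iq ir.
  have icp : nu.-integrable setT (EFin \o (fun x => c * p x)).
    exact: (integrableZl measurableT c ip).
  have ieq : nu.-integrable setT (EFin \o (fun x => e * q x)).
    exact: (integrableZl measurableT e iq).
  rewrite (RintegralD (f1 := fun x => c * p x + e * q x) (f2 := r))//; last first.
    exact: (integrableD measurableT icp ieq).
  by rewrite (RintegralD measurableT icp ieq) (RintegralZl c measurableT ip) (RintegralZl e measurableT iq).
apply/eqP; rewrite eq_complex/= -!mulNr; apply/andP; split; apply/eqP.
- rewrite -lin//; apply: eq_Rintegral => x _; rewrite /re /im.
  by case: (F x) (G x) => [? ?] [? ?] /=; ring.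
- rewrite -lin//; apply: eq_Rintegral => x _; rewrite /re /im.
  by case: (F x) (G x) => [? ?] [? ?] /=; ring.
Qed.

Lemma eq_cintegral F G : F =1 G -> cintegral nu F = cintegral nu G.
Proof. by move=> FG; congr Complex; apply: eq_Rintegral => x _; rewrite FG. Qed.

Lemma cintegralJ F : cintegrable F ->
  cintegral nu (fun x => (F x)^*%C) = (cintegral nu F)^*%C.
Proof.
move=> [rF jF]; congr Complex.
  by apply: eq_Rintegral => x _; case: (F x).
rewrite -[RHS]mulN1r -(RintegralZl (-1) measurableT jF).
by apply: eq_Rintegral => x _; rewrite mulN1r /im; case: (F x).
Qed.

Lemma L2_ip_self (f : L2 nu) : ip f f = (fine (L2sq f))%:C%C.
Proof.
rewrite /ip/= /cintegral; congr Complex.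
  rewrite /Rintegral; congr fine; apply: eq_integral => x _.
  by congr EFin; case: (f x) => a b; rewrite /normc_sq/=; ring.
rewrite /Rintegral (eq_integral (cst 0%E)) ?integral0// => x _.
by congr EFin; case: (f x) => a b /=; ring.
Qed.

Lemma L2_nsq (f : L2 nu) : nsq f = fine (L2sq f).
Proof. by rewrite /nsq L2_ip_self. Qed.

Lemma square_integrable_le f g (M : R) : cmeasurable f -> square_integrable nu g ->
  0 <= M -> (forall x, normc_sq (f x) <= M * normc_sq (g x)) ->
  square_integrable nu f /\ (L2sq f <= M%:E * L2sq g)%E.
Proof.
move=> mf hg M0 fg; have /square_integrableP[mg gfin] := hg.
suff le : (L2sq f <= M%:E * L2sq g)%E.
  split=> //; apply/square_integrableP; split=> //.
  by rewrite (le_lt_trans le)// lte_mul_pinfty// L2sq_fin.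
rewrite /L2sq -ge0_integralZl//; last 2 first.
- exact: measurable_normc_sq.
- by move=> x _; rewrite lee_fin normc_sq_ge0.
apply: ge0_le_integral => //.
- by move=> x _; rewrite lee_fin normc_sq_ge0.
- exact: measurable_normc_sq.
- apply: emeasurable_funM => //; exact: measurable_normc_sq.
- by move=> x _; rewrite -EFinM lee_fin.
Qed.

Lemma L2_subspace : subspace_dom (L2 nu).
Proof.
split.
  apply/square_integrableP; split; first by split; exact: measurable_cst.
  rewrite /L2sq (eq_integral (cst 0%E)) ?integral0// => x _.
  by rewrite /normc_sq/= expr0n addr0.
move=> a f g hf hg; have /square_integrableP[mf ff] := hf.
have /square_integrableP[mg fg] := hg.
apply/square_integrableP; split; first exact: cmeasurableZD.
have c0 : 0 <= 2 * normc_sq a by rewrite mulr_ge0// normc_sq_ge0.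
apply: (@le_lt_trans _ _ ((2 * normc_sq a)%:E * L2sq f + 2%:E * L2sq g)%E).
  rewrite /L2sq -!ge0_integralZl//; last 4 first.
  - exact: measurable_normc_sq.
  - by move=> x _; rewrite lee_fin normc_sq_ge0.
  - exact: measurable_normc_sq.
  - by move=> x _; rewrite lee_fin normc_sq_ge0.
  have mm (c : R) h : cmeasurable h ->
      measurable_fun [set: borel X] (fun x : borel X => (c%:E * (normc_sq (h x))%:E)%E).
    by move=> mh; apply: emeasurable_funM => //; exact: measurable_normc_sq.
  rewrite -ge0_integralD//; last 4 first.
  - by move=> x _; rewrite mule_ge0// lee_fin normc_sq_ge0.
  - exact: mm.
  - by move=> x _; rewrite mule_ge0// lee_fin normc_sq_ge0.
  - exact: mm.
  apply: ge0_le_integral => //.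
  - by move=> x _; rewrite lee_fin normc_sq_ge0.
  - by apply: measurable_normc_sq; exact: cmeasurableZD.
  - by apply: emeasurable_funD; exact: mm.
  - move=> x _; rewrite -!EFinM -EFinD lee_fin -mulrA -normc_sqM.
    exact: normc_sqD_le.
by rewrite lte_add_pinfty// lte_mul_pinfty// ?L2sq_fin// ?lee_fin.
Qed.

Lemma L2_inner_product : inner_product (L2 nu).
Proof.
split.
- move=> a f g h hf hg hh.
  rewrite -cintegralZD; [|exact: square_integrable_mul..].
  by apply: eq_cintegral => x; rewrite mulrA -mulrDl.
- move=> f g hf hg.
  transitivity (cintegral nu (fun x => (f x * (g x)^*%C)^*%C)); last first.
    by apply: cintegralJ; exact: square_integrable_mul.
  by apply: eq_cintegral => x; case: (f x) (g x) => [a b] [c e]; congr Complex; ring.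
- by move=> f hf; rewrite L2_ip_self lecR fine_ge0// L2sq_ge0.
Qed.

Lemma L2_complete : complete_space (L2 nu).
Proof.
have Hs := L2_subspace; have Hi := L2_inner_product.
apply/complete_spaceP => u du uC.
have mu n : cmeasurable (u n) by have /square_integrableP[] := du n.
have duB m n : square_integrable nu (u m - u n) := domB Hs (du m) (du n).
have muB m n : cmeasurable (u m - u n) by have /square_integrableP[] := duB m n.
(* To be used with [p] the real and the imaginary part: both are additive and do not increase the
   L^2 distance, which reduces the claim to the real case. *)
have key (p : R[i] -> R) :
    (forall z w, p (z - w) = p z - p w) ->
    (forall n, measurable_fun [set: borel X] (fun x : borel X => p (u n x))) ->
    (forall m n, (sqn nu (fun x : borel X => p (u m x - u n x)%R) <= L2sq (u m - u n)%R)%E) ->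
    exists2 l : borel X -> R, measurable_fun setT l &
      forall e : R, 0 < e -> exists N : nat, forall n : nat,
      (N <= n)%N -> (sqn nu (fun x : borel X => p (u n x) - l x)%R <= e%:E)%E.
  move=> pB mp bp.
  have [|l ml hl] := @riesz_fischer _ (borel X) R nu (fun n x => p (u n x)) mp; last by exists l.
  move=> e e0.
  have [N hN] := uC e e0; exists N => m n Nm Nn.
  have -> : (fun x : borel X => p (u m x)) \- (fun x => p (u n x)) =
      fun x => p (u m x - u n x) by apply/funext => x; rewrite pB.
  apply: le_lt_trans (bp m n) _.
  by rewrite -(fineK (L2sq_fin (duB m n))) lte_fin -L2_nsq; exact: hN.
have [|m n|l1 m1 h1] := key (@complex.Re R) (fun z w => raddfB _ z w).
- by move=> n; exact: (mu n).1.
- by rewrite L2sqE// leeDl// sqn_ge0.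
have [|m n|l2 m2 h2] := key (@complex.Im R) (fun z w => raddfB _ z w).
- by move=> n; exact: (mu n).2.
- by rewrite L2sqE// leeDr// sqn_ge0.
pose l : X -> R[i]^o := fun x => (l1 x +i* l2 x)%C.
have ml : cmeasurable l by [].
have mul n : cmeasurable (u n - l).
  have := cmeasurableZD (-1) ml (mu n); congr cmeasurable.
  by apply/funext => x; rewrite mulN1r addrC.
have ul (e : R) : 0 < e -> exists N : nat, forall n : nat, (N <= n)%N ->
    (L2sq (u n - l)%R <= e%:E)%E.
  move=> e0; have e2 : 0 < e / 2 by rewrite divr_gt0.
  have [N1 hN1] := h1 _ e2; have [N2 hN2] := h2 _ e2.
  exists (maxn N1 N2) => n; rewrite geq_max => /andP[/hN1 {}hN1 /hN2 {}hN2].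
  rewrite L2sqE// [e]splitr EFinD leeD//.
  - rewrite (_ : re _ = fun x => complex.Re (u n x) - l1 x)//.
    by apply/funext => x; rewrite /re raddfB.
  - rewrite (_ : im _ = fun x => complex.Im (u n x) - l2 x)//.
    by apply/funext => x; rewrite /im raddfB.
have dul n (e : R) : (L2sq (u n - l)%R <= e%:E)%E -> square_integrable nu (u n - l).
  move=> le; apply/square_integrableP; split=> //.
  by rewrite (le_lt_trans le)// ltry.
have dl : square_integrable nu l.
  have [N /(_ N (leqnn N)) hN] := ul 1 ltr01.
  by have := domB Hs (du N) (dul _ _ hN); rewrite subKr.
exists l => // e e0; have e2 : 0 < e / 2 by rewrite divr_gt0.
have [N hN] := ul _ e2; exists N => n /hN le.
rewrite L2_nsq (@le_lt_trans _ _ (e / 2))//; last by lra.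
by rewrite -lee_fin fineK// L2sq_fin//; exact: dul le.
Qed.

Lemma L2_hilbert : hilbert (L2 nu).
Proof. split; [exact: L2_subspace|exact: L2_inner_product|exact: L2_complete]. Qed.

End complex_L2.

(** * Densities between sigma-finite measures *)

Section densities.
Context d (T : measurableType d) (R : realType).
Implicit Types (mu nu : {measure set T -> \bar R}) (f : T -> \bar R) (D : T -> R).

Definition has_density mu (nu : set T -> \bar R) D :=
  [/\ measurable_fun [set: T] D, forall x, 0 <= D x &
    forall A, measurable A -> nu A = (\int[mu]_(x in A) (D x)%:E)%E].

Lemma radon_nikodym_ex_fin mu nu (E : set T) : sigma_finite setT mu ->
  (forall A, measurable A -> mu A = 0%E -> nu A = 0%E) ->
  measurable E -> (nu E < +oo)%E ->
  exists D, [/\ measurable_fun [set: T] D, forall x, 0 <= D x &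
    forall A, measurable A -> nu (A `&` E) = (\int[mu]_(x in A) (D x)%:E)%E].
Proof.
move=> smu numu mE nuE.
have fmu := isSFinite.Build d T R mu (sfinite_measure_sigma_finite smu).
pose m : {sigma_finite_measure set T -> \bar R} :=
  HB.pack (mu : set T -> \bar R) (Measure.class mu) fmu
    (isSigmaFinite.Build d T R mu smu).
(* Restricting [nu] to [E] makes it finite, as the Radon-Nikodym theorem applied below requires of
   the dominated measure. *)
pose n : {finite_measure set T -> \bar R} := mfrestr mE nuE.
have nm : n `<< m.
  apply/null_content_dominatesP => A mA mA0.
  rewrite /n/= /mfrestr /mrestr; apply/eqP; rewrite -measure_le0.
  rewrite -(numu A mA mA0) le_measure ?inE//; exact: measurableI.
have [g [g0 gfin gint ng]] := radon_nikodym_sigma_finite nm.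
exists (fine \o g); split.
- apply: measurableT_comp => //; exact: (measurable_int m gint).
- by move=> x; rewrite fine_ge0.
- move=> A mA; rewrite -[LHS](_ : n A = _)// ng//.
  by apply: eq_integral => x _; rewrite /= fineK.
Qed.

Lemma nneseries_single (a : nat -> \bar R) (k : nat) : (forall j, 0 <= a j)%E ->
  (forall j, j != k -> a j = 0%E) -> (\sum_(j <oo) a j = a k)%E.
Proof.
move=> a0 ak; rewrite nneseries_esumT// (esumID [set k])// setTI.
rewrite esum_set1// esum1 ?adde0// => j [_ /eqP]; exact: ak.
Qed.

(** [nu] is cut along disjoint pieces [E k] of finite measure and the densities of the pieces are
    glued. By disjointness the glued series has at most one nonzero term at each point, so it is
    finite everywhere and [fine] loses nothing. *)
Lemma radon_nikodym_ex mu nu : sigma_finite setT mu -> sigma_finite setT nu ->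
  (forall A, measurable A -> mu A = 0%E -> nu A = 0%E) ->
  exists D, has_density mu nu D.
Proof.
move=> smu [F TF /all_and2[mF nuF]] numu.
pose E := seqDU F.
have mE k : measurable (E k).
  by apply: measurableD => //; exact: bigsetU_measurable.
have nuE k : (nu (E k) < +oo)%E.
  by rewrite (le_lt_trans _ (nuF k))// le_measure ?inE//; exact: subDsetl.
have tE := @trivIset_seqDU _ F.
have UE : \bigcup_k E k = [set: T] by rewrite TF [RHS]seqDU_bigcup_eq.
have /choice[g hg] := fun k => radon_nikodym_ex_fin smu numu (mE k) (nuE k).
have mg k : measurable_fun setT (g k) by have [] := hg k.
have g0 k x : 0 <= g k x by have [_ + _] := hg k; apply.
pose h k x := g k x * \1_(E k) x.
have h0 k x : 0 <= h k x by rewrite mulr_ge0.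
have mh k : measurable_fun setT (h k) by exact: measurable_funM.
have kx x : exists k, E k x.
  by have : (\bigcup_k E k) x; [rewrite UE|move=> [k _ Ekx]; exists k].
have hs x : exists k, (\sum_(j <oo) (h j x)%:E = (h k x)%:E)%E.
  have [k Ekx] := kx x; exists k; apply: nneseries_single => j.
    by rewrite lee_fin.
  move=> jk; rewrite /h indicE memNset ?mulr0// => Ejx.
  by move/trivIsetP: tE => /(_ j k I I jk) => /seteqP[+ _] => /(_ x); apply.
have hfin x : (\sum_(j <oo) (h j x)%:E)%E \is a fin_num.
  by have [k ->] := hs x.
have mS : measurable_fun setT (fun x => (\sum_(j <oo) (h j x)%:E)%E).
  have mh' k : measurable_fun setT (fun x => (h k x)%:E) by exact/measurable_EFinP.
  exact: (@ge0_emeasurable_sum _ T R setT (fun k x => (h k x)%:E) xpredT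
    (fun k x _ _ => h0 k x) (fun k _ => mh' k)).
exists (fun x => fine (\sum_(j <oo) (h j x)%:E)%E); split.
- exact: measurableT_comp.
- by move=> x; rewrite fine_ge0// nneseries_ge0// => *; rewrite lee_fin.
- move=> A mA; under eq_integral do rewrite fineK//.
  rewrite integral_nneseries//; last 2 first.
  - by move=> k; apply/measurable_EFinP; exact: measurable_funTS.
  - by move=> k x _; rewrite lee_fin.
  rewrite -{1}(setIT A) -UE setI_bigcupr measure_bigcup//; last 2 first.
  - by move=> k _; exact: measurableI.
  - exact: trivIset_setIl.
  rewrite (@eq_eseriesl _ _ xpredT); last by move=> k; rewrite in_setT.
  apply: eq_eseriesr => k _.
  (* Writing [A E_k] as [(A E_k) E_k] (intersections) restricts the integral of [g k] to [A E_k],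
     which produces the indicator in [h k]. *)
  have [_ _ ng] := hg k; rewrite -{1}(setIid (E k)) setIA ng; last exact: measurableI.
  rewrite integral_mkcondr; apply: eq_integral => x _.
  by rewrite epatch_indic.
Qed.

Import HBNNSimple.

(** For simple functions this is the density property on level sets; monotone convergence on both
    sides extends it to [f]. *)
Lemma ge0_integral_density mu nu D f : has_density mu nu D ->
  (forall x, 0 <= f x)%E -> measurable_fun [set: T] f ->
  (\int[nu]_x f x = \int[mu]_x (f x * (D x)%:E))%E.
Proof.
move=> [mD D0 nuD] f0 mf.
pose h := nnsfun_approx measurableT mf.
have mh n : measurable_fun setT (EFin \o h n) by exact/measurable_EFinP.
have h0 n x : (0 <= (EFin \o h n) x)%E by rewrite lee_fin.
have hnd x a b : (a <= b)%N -> ((EFin \o h a) x <= (EFin \o h b) x)%E.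
  by move=> ab; rewrite lee_fin; exact/lefP/nd_nnsfun_approx.
have hf x : (EFin \o h n) x @[n --> \oo] --> f x by exact: cvg_nnsfun_approx.
have mDE : measurable_fun setT (EFin \o D) by exact/measurable_EFinP.
transitivity (limn (fun n => \int[nu]_x (EFin \o h n) x)%E).
  rewrite -monotone_convergence//; last by move=> x _ a b; exact: hnd.
  by apply: eq_integral => x _; apply/esym/cvg_lim.
transitivity (limn (fun n => \int[mu]_x ((EFin \o h n) x * (D x)%:E))%E); last first.
  rewrite -monotone_convergence//.
  - by apply: eq_integral => x _; apply/cvg_lim => //; apply: cvgeZr.
  - by move=> n; exact: emeasurable_funM.
  - by move=> n x _; rewrite mule_ge0// lee_fin.
  - by move=> x _ a b ab; rewrite lee_wpmul2r ?lee_fin//; exact: hnd.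
congr (limn _); apply/funext => n.
rewrite /comp integralT_nnsfun sintegralE.
have -> : (\int[mu]_x ((EFin \o h n) x * (D x)%:E) =
    \int[mu]_x (\sum_(y \in range (h n))
      ((y * \1_(h n @^-1` [set y]) x)%:E * (D x)%:E)))%E.
  apply: eq_integral => x _; rewrite /= {1}fimfunE -fsumEFin//.
  by rewrite ge0_mule_fsuml// => y; exact: nnfun_muleindic_ge0.
rewrite ge0_integral_fsum//; last 2 first.
- move=> y; apply: emeasurable_funM => //; apply/measurable_EFinP.
  exact: measurable_funM.
- by move=> y x _; rewrite mule_ge0 ?lee_fin//; exact: nnfun_muleindic_ge0.
apply: eq_fsbigr => y /set_mem[x _ yx].
have y0 : 0 <= y by rewrite -yx.
rewrite nuD// integral_mkcond epatch_indic -ge0_integralZl//.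
- by apply: eq_integral => t _ /=; rewrite EFinM muleAC -!muleA.
- by apply: emeasurable_funM => //; exact/measurable_EFinP.
- by move=> t _; rewrite mule_ge0 ?lee_fin.
Qed.

(** Equality of integrals identifies functions only when one is integrable. The sets [G n m], of
    finite measure and with [D1] bounded by [m], provide this; they cover [E], and countably many
    null sets are discarded. *)
Lemma density_ae_unique mu (E : set T) D1 D2 : sigma_finite setT mu ->
  measurable E -> measurable_fun [set: T] D1 -> measurable_fun [set: T] D2 ->
  (forall x, 0 <= D1 x) ->
  (forall A, measurable A -> A `<=` E ->
    (\int[mu]_(x in A) (D1 x)%:E = \int[mu]_(x in A) (D2 x)%:E)%E) ->
  {ae mu, forall x, E x -> D1 x = D2 x}.
Proof.
move=> [F TF /all_and2[mF muF]] mE m1 m2 d1 e12.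
pose G n m := E `&` (F n `&` [set x | D1 x <= m%:R]).
have mG n m : measurable (G n m).
  apply: measurableI => //; apply: measurableI => //.
  by rewrite -[X in measurable X]setTI; exact: measurable_fun_le.
have ae n m : {ae mu, forall x, G n m x -> (EFin \o D1) x = (EFin \o D2) x}.
  apply: (integral_ae_eq (mG n m)).
  - apply/integrableP; split.
      by apply/measurable_EFinP; exact: measurable_funTS.
    apply: (@le_lt_trans _ _ (\int[mu]_(x in G n m) (cst m%:R%:E x))%E).
      apply: ge0_le_integral => //.
      + by apply/measurable_EFinP; apply: measurableT_comp => //; exact: measurable_funTS.
      + by move=> x [_ [_ Dm]]; rewrite /= lee_fin ger0_norm.
    rewrite integral_cst// lte_mul_pinfty ?lee_fin//.
    rewrite (le_lt_trans _ (muF n))// le_measure ?inE//.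
    by move=> x [_ []].
  - by apply/measurable_EFinP; exact: measurable_funTS.
  - by move=> A AG mA; apply: e12 => // x /AG[].
have := ae_foralln (fun n => ae_foralln (ae n)).
apply: filterS => x hx Ex.
have : (\bigcup_n F n) x by rewrite -TF.
move=> [n _ Fnx].
have Gx : G n (Num.bound (D1 x)) x.
  by split=> //; split=> //=; apply: ltW; apply: archi_boundP.
by have [] := hx n _ Gx.
Qed.

Lemma ae_imply mu (P Q : T -> Prop) : (forall x, P x -> Q x) ->
  {ae mu, forall x, P x} -> {ae mu, forall x, Q x}.
Proof. by move=> PQ; apply: filterS. Qed.

End densities.

(** * Borel measurability of continuous maps, and almost everywhere equality in L^2 *)

Section borel_functions.
Variables (R : realType) (X : ptopologicalType).

Lemma open_borel (U : set (borel X)) : open (U : set X) -> measurable U.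
Proof. by move=> oU; exact: sub_sigma_algebra. Qed.

Lemma continuous_borel (f : X -> X) : continuous f ->
  measurable_fun [set: borel X] (f : borel X -> borel X).
Proof.
move=> cf; apply: (@measurability _ _ (borel X) (borel X) _ _ (@open X)) => //.
by move=> _ [U oU <-]; rewrite setTI; apply: open_borel; move/continuousP: cf; exact.
Qed.

Lemma continuous_borel_real (f : X -> R) : continuous f ->
  measurable_fun [set: borel X] (f : borel X -> R).
Proof.
move=> cf; apply: (measurability _ (RGenOpens.measurableE R)).
move=> _ [_ [a [b ->]] <-]; rewrite setTI; apply: open_borel.
by move/continuousP: cf; apply; exact: interval_open.
Qed.

Lemma CX_cmeasurable (f : X -> R[i]) : CX f -> cmeasurable f.
Proof.
by move=> /CX_Re_Im[cr ci]; split; exact: continuous_borel_real.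
Qed.

Lemma L2_veq_ae (nu : {measure set (borel X) -> \bar R}) (f g : L2 nu) :
  dom f -> dom g -> {ae nu, forall x, f x = g x} -> veq f g.
Proof.
move=> df dg fg; have Hs := L2_subspace nu.
have dfg : square_integrable nu (f - g) := domB Hs df dg.
have /square_integrableP[mfg _] := dfg.
rewrite /veq L2_ip_self (_ : L2sq nu (f - g) = 0%E)//.
rewrite /L2sq (ge0_ae_eq_integral (g := cst 0%E)) ?integral0//.
- exact: measurable_normc_sq.
- by move=> x _; rewrite lee_fin normc_sq_ge0.
- apply: ae_imply fg => x fgx _ /=.
  have -> : (f - g) x = 0 by rewrite -[LHS]/(f x - g x) fgx subrr.
  by rewrite /normc_sq/= expr0n addr0.
Qed.

End borel_functions.

(** * The Koopman representation *)

Section koopman.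
Variables (R : realType) (X : ptopologicalType) (G : groupType).
Variables (act : G -> X -> X) (nu : {measure set (borel X) -> \bar R}).
Hypothesis cact : continuous_action act.
Hypothesis snu : sigma_finite setT nu.
Hypothesis qnu : quasi_invariant nu act.

Lemma measurable_act g : measurable_fun [set: borel X] (act g : borel X -> borel X).
Proof. by apply: continuous_borel; case: cact. Qed.

(** The measure [g nu], that is, the pushforward of [nu] under [act g] with its structure of
    measure. *)
Definition translate g : {measure set (borel X) -> \bar R} :=
  measure_function_pushforward__canonical__measure_function_Measure
    nu (measurable_act g).

Lemma translateE g A : translate g A = nu (act g @^-1` A).
Proof. by []. Qed.

Lemma sigma_finite_translate g : sigma_finite setT (translate g).
Proof.
have [F TF mF] := snu; exists (fun n => act g^-1%g @^-1` F n).
  by rewrite -preimage_bigcup -TF preimage_setT.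
move=> n; have [mFn Fn] := mF n; split.
  by rewrite -[X in measurable X]setTI; exact: measurable_act.
rewrite translateE -comp_preimage (_ : _ @^-1` F n = F n)//.
by apply/seteqP; split=> x /=; rewrite (actK cact).
Qed.

Local Notation D g := (RN_derivative nu act g).

(** The default value of [RN_derivative] is never taken: quasi-invariance makes [g nu] absolutely
    continuous with respect to [nu], and both are sigma-finite. *)
Lemma RN_derivativeP g : is_RN_derivative nu act g (D g).
Proof.
apply: xgetPex.
have [|d [md d0 dE]] := radon_nikodym_ex snu (sigma_finite_translate g).
  by move=> A mA /(qnu g mA).2.
by exists d.
Qed.

Lemma measurable_RN g : measurable_fun [set: borel X] (D g : borel X -> R).
Proof. by case: (RN_derivativeP g). Qed.

Lemma RN_ge0 g x : 0 <= D g x.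
Proof. by case: (RN_derivativeP g). Qed.

Lemma RN_density g : has_density nu (translate g) (D g).
Proof. by case: (RN_derivativeP g) => mD D0 DE; split. Qed.

(** Both sides are the integral of [F] against [g nu], computed as a pushforward and through its
    density. *)
Lemma integral_translate g (F : borel X -> \bar R) : (forall x, 0 <= F x)%E ->
  measurable_fun [set: borel X] F ->
  (\int[nu]_(x in [set: borel X]) F (act g x) =
   \int[nu]_(x in [set: borel X]) (F x * (D g x)%:E))%E.
Proof.
move=> F0 mF; rewrite -(ge0_integral_density (RN_density g))//.
by rewrite (ge0_integral_pushforward (measurable_act g)).
Qed.

Lemma measurable_comp_act g (F : borel X -> \bar R) :
  measurable_fun [set: borel X] F ->
  measurable_fun [set: borel X] (fun x => F (act g x)).
Proof. by move=> mF; exact: (measurableT_comp mF (measurable_act g)). Qed.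

Lemma measurable_preimage_act g (A : set (borel X)) : measurable A ->
  measurable (act g @^-1` A : set (borel X)).
Proof. by move=> mA; rewrite -[X in measurable X]setTI; exact: measurable_act. Qed.

(** A Borel subset of [U] is its own preimage under [act g], by injectivity of [act g]. So [D g] and
    the constant 1 have the same integral over it, and uniqueness of densities applies. *)
Lemma RN_fixed g (U : set (borel X)) : measurable U ->
  (forall x, U x -> act g x = x) -> {ae nu, forall x, U x -> D g x = 1}.
Proof.
move=> mU gU; apply: (density_ae_unique snu mU) => //.
- exact: measurable_RN.
- exact: RN_ge0.
move=> A mA AU; have [_ _ <-] := RN_derivativeP g => //.
rewrite integral_cst// mul1e; congr (nu _); apply/seteqP; split=> x /= Ax.
  have xx : act g x = x by apply: (can_inj (actK cact g)); exact/gU/AU.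
  by rewrite -xx.
by rewrite gU//; exact: AU.
Qed.

Lemma RN_cocycle g h :
  {ae nu, forall x, D (g * h)%g x = D g x * D h (act g^-1%g x)}.
Proof.
have mDh : measurable_fun [set: borel X] (fun x => D h (act g^-1%g x) : R).
  exact: (measurableT_comp (measurable_RN h) (measurable_act g^-1%g)).
have := @density_ae_unique _ _ R nu setT (D (g * h)%g)
  (fun x => D g x * D h (act g^-1%g x)) snu measurableT (measurable_RN _)
  (measurable_funM (measurable_RN g) mDh) (RN_ge0 _).
suff E A : measurable A -> (\int[nu]_(x in A) (D (g * h)%g x)%:E =
    \int[nu]_(x in A) (D g x * D h (act g^-1%g x))%:E)%E.
  move=> /(_ (fun A mA _ => E A mA)); apply: ae_imply => x; exact.
move=> mA; have [_ _ <-] := RN_derivativeP (g * h)%g => //.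
have -> : act (g * h)%g @^-1` A = act h @^-1` (act g @^-1` A).
  by case: cact => _ aM _; apply/seteqP; split=> x /=; rewrite aM.
have [_ _ ->] := RN_derivativeP h; last exact: measurable_preimage_act.
rewrite integral_mkcond epatch_indic [RHS]integral_mkcond epatch_indic.
(* Chosen so that [F (act g x)] is [D h x] times the indicator of [act g @^-1 A], the integrand for
   [(g h) nu]; [integral_translate] then brings in [D g]. *)
pose F (x : borel X) : \bar R := ((D h (act g^-1%g x))%:E * (\1_A x)%:E)%E.
have F0 x : (0 <= F x)%E by rewrite /F mule_ge0 ?lee_fin ?RN_ge0.
have mF : measurable_fun [set: borel X] F.
  by apply: emeasurable_funM; apply/measurable_EFinP.
have e := integral_translate g F0 mF.
transitivity (\int[nu]_(x in [set: borel X]) F (act g x))%E.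
  by apply: eq_integral => x _; rewrite /F/= (actK cact).
rewrite e; apply: eq_integral => x _ /=.
by rewrite muleAC [in RHS]EFinM [((D g x)%:E * _)%E]muleC.
Qed.

Lemma RN_one : {ae nu, forall x, D 1%g x = 1}.
Proof.
have := @RN_fixed 1%g setT measurableT.
case: cact => a1 _ _ /(_ (fun x _ => a1 x)); apply: ae_imply => x; exact.
Qed.

Local Notation K := (koopman nu act).

Lemma cmeasurable_comp_act g f : @cmeasurable R X f ->
  cmeasurable (fun x => f (act g x)).
Proof.
by move=> [mr mi]; split; [exact: (measurableT_comp mr (measurable_act g))
  |exact: (measurableT_comp mi (measurable_act g))].
Qed.

Lemma koopman_cmeasurable g (f : L2 nu) : cmeasurable f ->
  cmeasurable (koopman_pi act g f).
Proof.
move=> mf; apply: cmeasurableM; last exact: cmeasurable_comp_act.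
split; last exact: measurable_cst.
exact: (measurableT_comp (continuous_measurable_fun (@sqrt_continuous R)) (measurable_RN g)).
Qed.

(** This is [integral_translate] for the function [|f (g^-1 x)|^2]: the square root in [koopman_pi]
    is there to produce exactly the factor [D g]. *)
Lemma koopman_L2sq g (f : L2 nu) : cmeasurable f ->
  L2sq nu (koopman_pi act g f) = L2sq nu f.
Proof.
move=> mf.
have mF : measurable_fun [set: borel X]
    (fun x : borel X => (normc_sq (f (act g^-1%g x)))%:E).
  exact: (measurable_comp_act g^-1%g (measurable_normc_sq mf)).
have F0 x : (0 <= (normc_sq (f (act g^-1%g x)))%:E)%E by rewrite lee_fin normc_sq_ge0.
have := integral_translate g F0 mF.
under eq_integral => x _ do rewrite (actK cact).
rewrite -/(L2sq nu f) => ->; apply: eq_integral => x _.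
rewrite /koopman_pi normc_sqM -EFinM mulrC; congr (_ * _)%:E.
by rewrite /normc_sq/= sqr_sqrtr ?RN_ge0// expr0n addr0.
Qed.

Lemma koopman_dom g (f : K) : dom f -> dom (rep_pi g f).
Proof.
move=> /square_integrableP[mf ff]; apply/square_integrableP; split.
  exact: koopman_cmeasurable.
by rewrite koopman_L2sq.
Qed.

Lemma koopman_unitary : unitary_representation K.
Proof.
have Hs := L2_subspace nu; have Hi := L2_inner_product nu.
have cm (f : K) : dom f -> cmeasurable f by move=> /square_integrableP[].
have pi1 (f : K) : dom f -> veq (rep_pi 1%g f) f.
  move=> df; apply: L2_veq_ae => //; first exact: koopman_dom.
  apply: ae_imply RN_one => x D1; rewrite /= /koopman_pi D1 sqrtr1 mul1r.
  by case: cact => a1 _ _; rewrite invg1 a1.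
have piM g h (f : K) : dom f -> veq (rep_pi (g * h)%g f) (rep_pi g (rep_pi h f)).
  move=> df; apply: L2_veq_ae; [exact: koopman_dom|exact/koopman_dom/koopman_dom|].
  apply: ae_imply (RN_cocycle g h) => x Dx; rewrite /= /koopman_pi Dx.
  rewrite sqrtrM ?RN_ge0// rmorphM/= -mulrA invgM.
  by case: cact => _ aM _; rewrite aM.
split=> // g; apply: isometry_unitary => //.
- exact: koopman_dom.
- move=> a x y dx dy; rewrite (_ : rep_pi g _ = a *: rep_pi g x + rep_pi g y).
    exact: veq_refl.
  by apply/funext => t; rewrite /= /koopman_pi mulrDr mulrCA.
- by move=> x dx; rewrite !L2_nsq koopman_L2sq//; exact: cm.
- move=> y dy; exists (rep_pi g^-1%g y); first exact: koopman_dom.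
  have d1 := koopman_dom 1%g dy; have dg := koopman_dom g (koopman_dom g^-1%g dy).
  apply: (veq_trans Hs Hi dg d1 dy); last exact: pi1.
  apply: (veq_sym Hs Hi d1 dg); rewrite -(mulgV g); exact: piM.
Qed.

Hypothesis cX : compact [set: X].

Lemma koopman_rho_le f (M : R) : CX f -> (forall x, normc_sq (f x) <= M) ->
  forall xi : K, dom xi -> dom (rep_rho f xi) /\ nsq (rep_rho f xi) <= M * nsq xi.
Proof.
move=> cf fM xi dxi; have /square_integrableP[mxi _] := dxi.
(* The base point of the pointed space [X] gives the sign of [M]. *)
have M0 : 0 <= M := le_trans (normc_sq_ge0 _) (fM point).
have mfx : cmeasurable (fun x => f x * xi x).
  by apply: cmeasurableM => //; exact: CX_cmeasurable.
have [] := square_integrable_le mfx dxi M0.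
  by move=> x; rewrite normc_sqM ler_wpM2r// normc_sq_ge0.
move=> dfx le; split=> //; rewrite !L2_nsq -lee_fin EFinM !fineK//; exact: L2sq_fin.
Qed.

Lemma koopman_covariant_rep : covariant_rep act K.
Proof.
have Hs := L2_subspace nu; have Hi := L2_inner_product nu.
have bd f : CX f -> bounded_operator (@rep_rho _ _ _ K f).
  move=> cf; have [M hM] := CX_bounded cX cf.
  apply: (@bounded_operator_sq _ K Hi _ M).
  - by move=> x dx; have [] := koopman_rho_le cf hM dx.
  - move=> a x y dx dy; rewrite (_ : rep_rho f _ = a *: rep_rho f x + rep_rho f y).
      exact: veq_refl.
    by apply/funext => t; rewrite /= mulrDr mulrCA.
  - by move=> x dx; have [] := koopman_rho_le cf hM dx.
split.
- exact: L2_hilbert.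
- exact: koopman_unitary.
- split; [exact: bd|split].
  + move=> a f1 f2 x c1 c2 dx.
    rewrite (_ : rep_rho _ x = a *: rep_rho f1 x + rep_rho f2 x).
      exact: veq_refl.
    by apply/funext => t; rewrite /= mulrDl -mulrA.
  + move=> f1 f2 x c1 c2 dx; rewrite (_ : rep_rho _ x = rep_rho f1 (rep_rho f2 x)).
      exact: veq_refl.
    by apply/funext => t; rewrite /= mulrA.
  + move=> x dx; rewrite (_ : rep_rho _ x = x); first exact: veq_refl.
    by apply/funext => t; rewrite /= mul1r.
  + move=> f x y cf dx dy; apply: eq_cintegral => t.
    by rewrite [in RHS]rmorphM/= mulrCA mulrA.
- move=> g f x cf dx.
  have cgf := CX_fun_act cact (g := g) cf.
  have [_ piV piM] := koopman_unitary.
  have dgx := koopman_dom g (koopman_dom g^-1%g dx).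
  (* The multiplication operator passes through [rep_pi g] pointwise; only the cancellation of
     [rep_pi g] with [rep_pi g^-1] is up to null sets. *)
  rewrite (_ : rep_pi g _ = rep_rho (fun_act act g f) (rep_pi g (rep_pi g^-1%g x))).
    apply: (bounded_veq Hs Hi (bd _ cgf) dgx dx).
    have d1 := koopman_dom 1%g dx.
    apply: (veq_trans Hs Hi dgx d1 dx); last exact: piV.
    by apply: (veq_sym Hs Hi d1 dgx); rewrite -(mulgV g); exact: piM.
  by apply/funext => t; rewrite /= /koopman_pi /fun_act mulrCA.
Qed.

End koopman.

(** * Germinality *)

Section germinal_induction.
Variables (R : realType) (Gamma : groupType) (X : ptopologicalType).
Variables (act : Gamma -> X -> X) (P : pred Gamma) (Lambda : subGroupType P).
Variables (T : set Gamma) (K : set X) (nu : {measure set (borel X) -> \bar R}).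
Hypothesis cX : compact [set: X].
Hypothesis cact : continuous_action act.
Hypothesis clK : closed K.
Hypothesis germK : forall x, K x -> germ_stabilizer act x `<=` [set g | P g].
Hypothesis nuK : nu (~` K) = 0%E.
Hypothesis snu : sigma_finite setT nu.
Hypothesis qnu : quasi_invariant nu (fun h : Lambda => act (val h)).
Hypothesis hT : left_transversal Lambda T.

Let actL (h : Lambda) := act (val h).
Let Koop := koopman nu actL.
Let Ind := induced_rep T act Koop.
Let cactL : continuous_action actL := restrict_action Lambda cact.
Let covK : covariant_rep actL Koop := koopman_covariant_rep cactL snu qnu cX.
Let Hs : subspace_dom Koop := L2_subspace nu.
Let Hi : inner_product Koop := L2_inner_product nu.

Lemma ind_koopman_covariant : covariant_rep act Ind.
Proof.
apply: (ind_covariant_rep hT cX cact covK) => f M cf fM x dx.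
exact: (koopman_rho_le cf fM dx).2.
Qed.

Section fixed_support.
Variables (g : Gamma) (f : X -> R[i]).
Hypothesis fg : supp f `<=` (fixed_points act g)°.

Lemma supp_fixed x : f x != 0 -> (fixed_points act g)° x.
Proof. by move=> fx; apply: fg; exact: subset_closure. Qed.

(** If [f] is nonzero at one of the points [x] and [act g^-1 x], that point is fixed by [g] and the
    two coincide; otherwise both values are 0. *)
Lemma fun_act_supp x : f (act g^-1%g x) = f x.
Proof.
have [fx|/eqP/supp_fixed/interior_subset gx] := pselect (f x = 0).
  have [fgx|/eqP/supp_fixed/interior_subset] := pselect (f (act g^-1%g x) = 0).
    by rewrite fgx fx.
  by rewrite /fixed_points/= (actVK cact) => <-.
by rewrite -{1}gx (actK cact).
Qed.

(** The required neighborhood of [x] is the preimage under [act r] of the interior of Fix(g), on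
    which [r^-1 g r] acts trivially. *)
Lemma conj_germ_stabilizer r x : f (act r x) != 0 ->
  germ_stabilizer act x (r^-1 * g * r)%g.
Proof.
move=> /supp_fixed gx; have [_ aM ac] := cact.
have : \forall y \near x, (fixed_points act g)° (act r y).
  by apply: (ac r x); apply: open_nbhs_nbhs; split=> //; exact: open_interior.
apply: filterS => y /interior_subset gy.
by rewrite !aM gy (actK cact).
Qed.

End fixed_support.

Lemma measurable_K : measurable (K : set (borel X)).
Proof.
by rewrite -[K]setCK; apply: measurableC; apply: open_borel; exact: closed_openC.
Qed.

Lemma ind_koopman_germinal : germinal act Ind.
Proof.
move=> g f x cf fg dx; apply: ind_veq => r Tr /=.
have dxt t : @dom _ Koop (x t) := ind_dom t dx.
pose F := fun_act act r^-1%g f.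
have cF : CX F := CX_fun_act cact (g := r^-1%g) cf.
have FE y : F y = f (act r y) by rewrite /F /fun_act invgK.
have -> : fun_act act (g^-1 * r)^-1%g f = F.
  apply/funext => y; have [_ aM _] := cact.
  by rewrite /fun_act invgK aM (fun_act_supp fg) FE.
rewrite -/F.
have bF : bounded_operator (@rep_rho _ _ _ Koop F).
  by case: covK => _ _ [+ _] _; apply.
have domF (y : Koop) : dom y -> dom (rep_rho F y).
  by case: bF => + _ _; apply.
have [[y [Ky Fy]]|noK] := pselect (exists y, K y /\ F y != 0); last first.
  apply: L2_veq_ae; [exact/domF/dxt|exact/domF/dxt|].
  exists (~` K : set (borel X)); split=> //.
    by apply: measurableC; exact: measurable_K.
  move=> y /= ney Ky; apply: ney.
  suff -> : F y = 0 by rewrite !mul0r.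
  by apply/eqP/negPn/negP => Fy; apply: noK; exists y.
have Ph : P (r^-1 * g * r)%g.
  by apply: (germK Ky); apply: (conj_germ_stabilizer fg); rewrite -FE.
pose h : Lambda := Sub _ Ph.
have hE : val h = (r^-1 * g * r)%g by rewrite /h SubK.
(* In this form the left translate by [g^-1] becomes a right translate by an element of [Lambda], to
   which the equivariance of [x] applies. *)
have gr : (g^-1 * r)%g = (r * val h^-1%g)%g.
  by rewrite valVg hE !invgM invgK !mulgA mulgV mul1g.
have e1 : veq (x (g^-1 * r)%g) (rep_pi h (x r)).
  by rewrite gr -{2}[h]invgK; exact: (ind_cov r h^-1%g dx).
have dpx : @dom _ Koop (rep_pi h (x r)) := koopman_dom cactL snu qnu h (dxt r).
apply: (veq_trans Hs Hi (domF _ (dxt _)) (domF _ dpx) (domF _ (dxt _))).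
  exact: (bounded_veq Hs Hi bF (dxt _) dpx e1).
apply: L2_veq_ae; [exact/domF|exact/domF/dxt|].
pose U : set (borel X) := act r @^-1` (fixed_points act g)°.
have mU : measurable U.
  apply: open_borel; have [_ _ /(_ r)/continuousP ac] := cact.
  by apply: ac; exact: open_interior.
have hU y0 : U y0 -> act (val h) y0 = y0.
  move=> /interior_subset gy; have [_ aM _] := cact.
  by rewrite hE !aM gy (actK cact).
(* Off [U] the function [F] vanishes; on [U] the Koopman weight is 1 almost everywhere and
   [act (val h)^-1] fixes [z]. *)
apply: ae_imply (RN_fixed cactL snu qnu mU hU) => z Dz /=.
have [->|Fz] := eqVneq (F z) 0; first by rewrite !mul0r.
have Uz : U z by apply: (supp_fixed fg); rewrite -FE.
rewrite /koopman_pi Dz// sqrtr1 mul1r; congr (_ * x r _).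
by rewrite /actL valVg -{1}(hU z Uz) (actK cact).
Qed.

End germinal_induction.

Theorem proposition3p5 (R : realType) (Gamma : groupType) (X : ptopologicalType)
    (act : Gamma -> X -> X) (P : pred Gamma) (Lambda : subGroupType P)
    (T : set Gamma) (K : set X) (nu : {measure set (borel X) -> \bar R}) :
  countable [set: Gamma] ->
  compact [set: X] -> hausdorff_space X ->
  continuous_action act ->
  closed K ->
  (forall (h : Lambda) x, K x -> K (act (\val h) x)) ->
  (forall x, K x -> germ_stabilizer act x `<=` [set g | P g]) ->
  nu (~` K) = 0%E ->
  sigma_finite setT nu ->
  quasi_invariant nu (fun h : Lambda => act (\val h)) ->
  left_transversal Lambda T ->
  let Ind := induced_rep T act (koopman nu (fun h : Lambda => act (\val h))) in
  covariant_rep act Ind /\ germinal act Ind.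
Proof.
move=> _ cX _ cact clK _ germK nuK snu qnu hT Ind; split.
- exact: ind_koopman_covariant.
- exact: (ind_koopman_germinal cX cact clK germK nuK snu qnu).
Qed.
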